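(* Let $\mathcal{F}$ be a finite set of Hadamard promise problems (HPPs), and let $\mathcal{C}$ be the class of HPPs generated from $\mathcal{F}$ by the composition method (notions defined in the context). Let $k_{max}$ be the largest number of gates among the HPPs in $\mathcal{F}$, and set $C:=2(k_{max}-1)$. Then for every problem in $\mathcal{C}$ with $n\ge 2$ black-box gates, there is a causal quantum algorithm that solves it and calls the black-box gates at most $C\cdot n\cdot\log_2(n)$ times.
   Context: Hadamard promise problem (HPP). A set of $n$ black-box unitary gates $U_1,\dots,U_n$ acting on $\mathbb{C}^d$ is given. Fixed products $\Pi_0,\dots,\Pi_{n_x-1}$ are selected, with $n_x\le n!$. Each $\Pi_x$ is a product in which every $U_i$ appears exactly once, in an order specified by a permutation. A Hadamard matrix $s(x,y)$ of size $n_x\times n_x$ is also fixed: $s(x,y)\in\{+1,-1\}$ and $\sum_x s(x,y)s(x,y')=n_x\delta_{y,y'}$. It is promised that there exists $y$ such that $\Pi_x=s(x,y)\,\Pi_0$ for all $x$. The task is to determine $y$. Composition method. Let HPP1 have $m$ gates, products $\Pi^{(1)}_{x_1}$ and Hadamard matrix $s_1$ (size $m_x$). Let HPP2 have $n'$ gates, products $\Pi^{(2)}_{x_2}$ and Hadamard matrix $s_2$ (size $n'_x$). Choose one gate of HPP1 and replace it, in every $\Pi^{(1)}_{x_1}$, by $\Pi^{(2)}_{x_2}$; the gates of HPP2 are new, distinct gates. This yields $m_xn'_x$ products $\Pi_{(x_1,x_2)}$ on $m+n'-1$ gates, with Hadamard matrix $s((x_1,x_2),(y_1,y_2))=s_1(x_1,y_1)s_2(x_2,y_2)$.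 The promise is that for some $(y_1,y_2)$, $\Pi_{(x_1,x_2)}=s((x_1,x_2),(y_1,y_2))\Pi_{(0,0)}$ for all $(x_1,x_2)$. The class $\mathcal{C}$ consists of the HPPs in $\mathcal{F}$ together with all HPPs obtained by repeatedly composing HPPs already in $\mathcal{C}$ (each time using fresh gates). Causal quantum algorithm. This is an ordinary quantum circuit on a finite-dimensional system (target and ancillas). It consists of fixed, instance-independent gates (e.g. Hadamard-type transforms and controlled swaps) and a fixed sequence of calls to the black-box gates. Each call applies some $U_i$ to a $d$-dimensional subsystem, in a fixed (not quantum-controlled) order. The circuit ends with a measurement in the computational basis. Solving the problem means outputting the promised $y$ for every tuple of unitaries satisfying the promise. The query count is the total number of black-box calls. *)

(* Defs.v *)
From HB Require Import structures.
From mathcomp Require Import all_boot all_order all_algebra.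
From mathcomp Require Import complex mxtens.
From mathcomp Require Import reals exp.
From Stdlib Require List.

Set Implicit Arguments.
Unset Strict Implicit.
Unset Printing Implicit Defensive.

Import Order.TTheory GRing.Theory Num.Theory.
Local Open Scope ring_scope.

(*   hpp_n     : number n of black-box gates, labelled 0 .. n-1        *)
(*   hpp_nx    : number n_x of products                                *)
(*   hpp_words : the products Pi_0, ..., Pi_{n_x-1}; the word          *)
(*               [:: i_0; i_1; ...; i_{n-1}] denotes U_{i_0} U_{i_1}   *)
(*               ... U_{i_{n-1}} (every gate occurs exactly once)      *)
(*   hpp_sign  : the Hadamard matrix s(x,y) (x,y < n_x)                *)
Record hpp := HPP {
  hpp_n : nat;
  hpp_nx : nat;
  hpp_words : seq (seq nat);
  hpp_sign : nat -> nat -> int }.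

Definition hpp_wf (P : hpp) : Prop :=
  [/\ (0 < hpp_nx P)%N,
      (hpp_nx P <= (hpp_n P)`!)%N,
      size (hpp_words P) = hpp_nx P &
      all (fun w => perm_eq w (iota 0 (hpp_n P))) (hpp_words P)] /\
  (forall x y, (x < hpp_nx P)%N -> (y < hpp_nx P)%N ->
          hpp_sign P x y = 1 \/ hpp_sign P x y = -1) /\
  (forall y y', (y < hpp_nx P)%N -> (y' < hpp_nx P)%N ->
          \sum_(x < hpp_nx P) hpp_sign P x y * hpp_sign P x y'
            = ((hpp_nx P * (y == y'))%N)%:Z).

Definition word_prod {C : pzRingType} (d : nat) (U : nat -> 'M[C]_d)
    (w : seq nat) : 'M[C]_d :=
  foldr (fun i M => U i *m M) 1%:M w.

Definition hpp_prod {C : pzRingType} (P : hpp) (d : nat)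
    (U : nat -> 'M[C]_d) (x : nat) : 'M[C]_d :=
  word_prod U (nth [::] (hpp_words P) x).

Definition hpp_promise {C : pzRingType} (P : hpp) (d : nat)
    (U : nat -> 'M[C]_d) (y : nat) : Prop :=
  (y < hpp_nx P)%N /\
  forall x, (x < hpp_nx P)%N ->
    hpp_prod P U x = (hpp_sign P x y)%:~R *: hpp_prod P U 0.

(* Composition: gate g of P is replaced, in every product of P, by     *)
(* the products of Q.  Gates of the result: the gates i <> g of P      *)
(* (relabelled i if i < g, i-1 if i > g) and the fresh gates of Q      *)
(* (gate j of Q becomes (n_P - 1) + j).  The pair (x1, x2) is encoded  *)
(* as x1 * n'_x + x2 (so (0,0) |-> 0), and similarly for (y1, y2).     *)
Definition comp_relabel (g i : nat) : nat := if (i < g)%N then i else i.-1.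

Definition comp_word (P : hpp) (g : nat) (w1 w2 : seq nat) : seq nat :=
  flatten [seq (if i == g then map (addn (hpp_n P).-1) w2
                else [:: comp_relabel g i]) | i <- w1].

Definition hpp_comp (P Q : hpp) (g : nat) : hpp :=
  HPP ((hpp_n P + hpp_n Q).-1)
      (hpp_nx P * hpp_nx Q)
      [seq comp_word P g w1 w2 | w1 <- hpp_words P, w2 <- hpp_words Q]
      (fun x y => hpp_sign P (x %/ hpp_nx Q) (y %/ hpp_nx Q)
                  * hpp_sign Q (x %% hpp_nx Q) (y %% hpp_nx Q)).

Inductive in_class (F : seq hpp) : hpp -> Prop :=
  | in_class_base P : List.In P F -> in_class F P
  | in_class_comp P Q g : in_class F P -> in_class F Q ->
      (g < hpp_n P)%N -> in_class F (hpp_comp P Q g).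

Definition kmax (F : seq hpp) : nat := \max_(P <- F) hpp_n P.

(* The system is C^d (target) (x) C^anc (ancillas).  The circuit       *)
(* starts in the computational basis state |0>, applies the fixed      *)
(* gate V_0, then for k = 0 .. L-1 the black-box call U_{c_k} on the   *)
(* target (U_{c_k} (x) 1) followed by the fixed gate V_{k+1}; it ends  *)
(* with a computational-basis measurement whose outcome o is mapped to *)
(* the answer out(o).  Calls on other d-dimensional subsystems are     *)
(* covered since the fixed gates are arbitrary unitaries (they can     *)
(* swap subsystems).                                                   *)
Definition unitarymx {C : numClosedFieldType} (m : nat) (A : 'M[C]_m) : Prop :=
  A *m (map_mx Num.conj A)^T = 1%:M.

Record causal_algo (C : numClosedFieldType) (d : nat) := CausalAlgo {
  ca_anc : nat;
  ca_len : nat;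
  ca_fixed : nat -> 'M[C]_(d * ca_anc);
  ca_call : nat -> nat;
  ca_out : 'I_(d * ca_anc) -> nat }.
Arguments ca_anc {C d} c.
Arguments ca_len {C d} c.
Arguments ca_fixed {C d} c _.
Arguments ca_call {C d} c _.
Arguments ca_out {C d} c _.

Definition ca_valid {C : numClosedFieldType} {d : nat} (n : nat)
    (A : causal_algo C d) : Prop :=
  [/\ (0 < ca_anc A)%N,
      (forall k, (k <= ca_len A)%N -> unitarymx (ca_fixed A k)) &
      (forall k, (k < ca_len A)%N -> (ca_call A k < n)%N)].

Definition ca_init {C : numClosedFieldType} (m : nat) : 'cV[C]_m :=
  \col_(i < m) (nat_of_ord i == 0%N)%:R.

Fixpoint ca_state {C : numClosedFieldType} {d : nat} (A : causal_algo C d)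
    (U : nat -> 'M[C]_d) (k : nat) : 'cV[C]_(d * ca_anc A) :=
  match k with
  | 0 => ca_fixed A 0 *m ca_init _
  | k'.+1 => ca_fixed A k'.+1 *m
             ((U (ca_call A k') *t (1%:M : 'M[C]_(ca_anc A))) *m ca_state A U k')
  end.

Definition ca_final {C : numClosedFieldType} {d : nat} (A : causal_algo C d)
    (U : nat -> 'M[C]_d) : 'cV[C]_(d * ca_anc A) :=
  ca_state A U (ca_len A).
Arguments ca_state {C d} A U k.
Arguments ca_final {C d} A U.

(* A solves P: for every tuple of unitaries satisfying the promise with
   answer y, every measurement outcome of nonzero probability yields y
   (i.e. the output is y with certainty). *)
Definition ca_solves {C : numClosedFieldType} {d : nat} (P : hpp)
    (A : causal_algo C d) : Prop :=
  forall (U : nat -> 'M[C]_d) (y : nat),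
    (forall i, (i < hpp_n P)%N -> unitarymx (U i)) ->
    hpp_promise P U y ->
    forall o : 'I_(d * ca_anc A), ca_final A U o 0 != 0 -> ca_out A o = y.

Definition ca_queries {C : numClosedFieldType} {d : nat} (A : causal_algo C d) : nat :=
  ca_len A.

(* Main.v *)
Require Import Defs.
From HB Require Import structures.
From mathcomp Require Import all_boot all_order all_algebra.
From mathcomp Require Import complex mxtens.
From mathcomp Require Import reals exp.
From mathcomp Require Import zify ring.
From Stdlib Require List.
Import Order.TTheory GRing.Theory Num.Theory.
(* [unitarymx] is also the name of a predicate in [mathcomp.spectral]. *)
Import Defs.
Local Open Scope ring_scope.

(** Prepare a control register in the uniform superposition of all [x], let
branch [x] use the black-box calls to build products on several target
registers, and apply the Hadamard transform to the control register: if the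
joint state of the targets depends on [x] only through the sign
[s(x,y) s(0,y)], the measurement yields [y].  A call that branch [x] does not
use acts on a dummy register reserved for its gate; the number of such calls
is the same in all branches, so the dummies do not get entangled with [x].

The targets correspond to the heavy paths of the composition tree: along a
heavy path, a gate of largest size occurs once and the others often enough on
both of its sides to accommodate every order.  A problem substituted for one of
these other gates is replaced by its product [Pi_0], which by its own promise
differs from every [Pi_x] by a sign only, and that sign is determined by a
separate target.  Every gate is thus repeated [2 (k - 1)] times for each
non-heavy edge above it, and there are at most [log_2 n] such edges. *)

(** * Controlled circuits *)

Lemma unitary_rowsP {C : numClosedFieldType} {m} (A : 'M[C]_m) :
  unitarymx A <-> forall i j, \sum_k A i k * (A j k)^* = (i == j)%:R.
Proof.
split=> [uA i j|uA].
  by have /matrixP/(_ i j) := uA; rewrite !mxE => <-; apply: eq_bigr => k _; rewrite !mxE.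
by apply/matrixP => i j; rewrite !mxE -uA; apply: eq_bigr => k _; rewrite !mxE.
Qed.

Lemma unitarymx1 {C : numClosedFieldType} {m} : unitarymx (1%:M : 'M[C]_m).
Proof. by rewrite /unitarymx map_mx1 trmx1 mulmx1. Qed.

Lemma unitarymxM {C : numClosedFieldType} {m} (A B : 'M[C]_m) :
  unitarymx A -> unitarymx B -> unitarymx (A *m B).
Proof.
rewrite /unitarymx => uA uB.
by rewrite map_mxM trmx_mul -mulmxA (mulmxA B) uB mul1mx.
Qed.

Lemma unitarymx_adj {C : numClosedFieldType} {m} (A : 'M[C]_m) :
  unitarymx A -> unitarymx (map_mx Num.conj A)^T.
Proof.
rewrite /unitarymx => uA; rewrite -map_trmx trmxK.
have -> : map_mx Num.conj (map_mx Num.conj A) = A.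
  by apply/matrixP => i j; rewrite !mxE conjCK.
exact: mulmx1C.
Qed.

Lemma unitarymx_lreg {C : numClosedFieldType} {m} (A X Y : 'M[C]_m) :
  unitarymx A -> A *m X = A *m Y -> X = Y.
Proof.
move=> /mulmx1C uA eqXY.
by rewrite -[X]mul1mx -uA -mulmxA eqXY mulmxA uA mul1mx.
Qed.

Lemma unitarymx_rreg {C : numClosedFieldType} {m} (A X Y : 'M[C]_m) :
  unitarymx A -> X *m A = Y *m A -> X = Y.
Proof.
rewrite /unitarymx => uA eqXY.
by rewrite -[X]mulmx1 -uA mulmxA eqXY -mulmxA uA mulmx1.
Qed.

(** * Basis states of the registers, and gates acting on them *)

Definition anc_basis (d nx : nat) (J : finType) : finType :=
  ('I_nx * {ffun J -> 'I_d})%type.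
(** The first factor is the port on which every black-box call acts. The ancillas are the control
    register and one register for each [j : J], brought to the port by a swap. *)
Definition basis (d nx : nat) (J : finType) : finType :=
  ('I_d * anc_basis d nx J)%type.
Notation anc_dim d nx J := #|{: anc_basis d nx J}|.

Definition enc {d nx} {J : finType} (b : basis d nx J) : 'I_(d * anc_dim d nx J) :=
  mxtens_index (b.1, enum_rank b.2).
Definition dec {d nx} {J : finType} (o : 'I_(d * anc_dim d nx J)) : basis d nx J :=
  ((mxtens_unindex o).1, enum_val (mxtens_unindex o).2).

Lemma encK {d nx} {J : finType} : cancel (@enc d nx J) dec.
Proof. by move=> [a e]; rewrite /enc /dec mxtens_indexK /= enum_rankK. Qed.

Lemma decK {d nx} {J : finType} : cancel (@dec d nx J) enc.
Proof.
move=> o; rewrite /enc /dec enum_valK -[RHS]mxtens_unindexK.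
by case: (mxtens_unindex o).
Qed.

Lemma sum_dec {C : numClosedFieldType} {d nx} {J : finType} (F : basis d nx J -> C) :
  \sum_i F (dec i) = \sum_b F b.
Proof.
rewrite [RHS](reindex dec) //=.
by exists enc => b _; rewrite ?encK ?decK.
Qed.

Definition basis_mx {C : numClosedFieldType} {d nx} {J : finType}
    (M : basis d nx J -> basis d nx J -> C) : 'M[C]_(d * anc_dim d nx J) :=
  \matrix_(i, j) M (dec i) (dec j).

Lemma basis_mx_mulE {C : numClosedFieldType} {d nx} {J : finType}
    (M : basis d nx J -> basis d nx J -> C) (v : 'cV_(d * anc_dim d nx J)) b :
  (basis_mx M *m v) (enc b) 0 = \sum_c M b c * v (enc c) 0.
Proof.
rewrite !mxE -sum_dec; apply: eq_bigr => i _.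
by rewrite !mxE encK decK.
Qed.

Lemma basis_mx_unitary {C : numClosedFieldType} {d nx} {J : finType}
    (M : basis d nx J -> basis d nx J -> C) :
  (forall b b', \sum_c M b c * (M b' c)^* = (b == b')%:R) ->
  unitarymx (basis_mx M).
Proof.
move=> uM; apply/unitary_rowsP => i j.
rewrite -(inj_eq (can_inj decK)) -uM -sum_dec.
by apply: eq_bigr => k _; rewrite !mxE.
Qed.

Definition perm_gate {C : numClosedFieldType} {d nx} {J : finType}
    (p : basis d nx J -> basis d nx J) : 'M[C]_(d * anc_dim d nx J) :=
  basis_mx (fun b c => (c == p b)%:R).

Lemma perm_gateE {C : numClosedFieldType} {d nx} {J : finType}
    (p : basis d nx J -> basis d nx J) (v : 'cV[C]_(d * anc_dim d nx J)) b :
  (perm_gate p *m v) (enc b) 0 = v (enc (p b)) 0.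
Proof.
rewrite basis_mx_mulE (bigD1 (p b)) //= eqxx mul1r big1 ?addr0 // => c.
by move=> /negbTE ->; rewrite mul0r.
Qed.

Lemma perm_gate_unitary {C : numClosedFieldType} {d nx} {J : finType}
    (p : basis d nx J -> basis d nx J) :
  injective p -> unitarymx (perm_gate p : 'M[C]_(d * anc_dim d nx J)).
Proof.
move=> inj_p; apply: basis_mx_unitary => b b'.
rewrite (bigD1 (p b)) //= eqxx mul1r big1 ?addr0 => [|c /negbTE ->]; last first.
  by rewrite mul0r.
by rewrite (inj_eq inj_p) conjC_nat.
Qed.

Definition swap_reg {d nx} {J : finType} (s : 'I_nx -> J) (b : basis d nx J) :
    basis d nx J :=
  (b.2.2 (s b.2.1),
   (b.2.1, [ffun j => if j == s b.2.1 then b.1 else b.2.2 j])).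

Lemma swap_regK {d nx} {J : finType} (s : 'I_nx -> J) :
  involutive (@swap_reg d nx J s).
Proof.
move=> [a [x f]]; rewrite /swap_reg /= ffunE eqxx.
congr (_, (_, _)); apply/ffunP => j; rewrite !ffunE.
by case: eqP => // ->.
Qed.

Definition ctrl_gate {C : numClosedFieldType} {d nx} {J : finType} (h : 'M[C]_nx) :
    'M[C]_(d * anc_dim d nx J) :=
  basis_mx (fun b c => (b.1 == c.1)%:R * ((b.2.2 == c.2.2)%:R
                        * h b.2.1 c.2.1)).

Lemma sum_prod_finType {C : numClosedFieldType} {I J : finType}
    (F : I * J -> C) : \sum_p F p = \sum_i \sum_j F (i, j).
Proof. by rewrite pair_bigA; apply: eq_bigr => -[]. Qed.

Lemma sum_basis_diag {C : numClosedFieldType} {d nx} {J : finType} (a : 'I_d)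
    (f : {ffun J -> 'I_d}) (G : basis d nx J -> C) :
  \sum_(c : basis d nx J) (a == c.1)%:R * ((f == c.2.2)%:R * G c) =
  \sum_x G (a, (x, f)).
Proof.
rewrite [LHS]sum_prod_finType /=.
rewrite (bigD1 a) //= [X in _ + X]big1 ?addr0 => [|a']; last first.
  by rewrite eq_sym => /negbTE ->; apply: big1 => e _; rewrite mul0r.
rewrite [LHS]sum_prod_finType /=.
apply: eq_bigr => x _; rewrite (bigD1 f) //= !eqxx !mul1r big1 ?addr0 // => f'.
by rewrite eq_sym => /negbTE ->; rewrite !mul0r mulr0.
Qed.

Lemma ctrl_gateE {C : numClosedFieldType} {d nx} {J : finType} (h : 'M[C]_nx)
    (v : 'cV[C]_(d * anc_dim d nx J)) a x f :
  (ctrl_gate h *m v) (enc (a, (x, f))) 0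
  = \sum_x' h x x' * v (enc (a, (x', f))) 0.
Proof.
rewrite basis_mx_mulE -(sum_basis_diag a f (fun c => h x c.2.1 * v (enc c) 0)).
by apply: eq_bigr => c _; rewrite !mulrA.
Qed.

Lemma ctrl_gate_unitary {C : numClosedFieldType} {d nx} {J : finType} (h : 'M[C]_nx) :
  unitarymx h -> unitarymx (ctrl_gate h : 'M[C]_(d * anc_dim d nx J)).
Proof.
move=> /unitary_rowsP uh; apply: basis_mx_unitary => -[a [x f]] [a' [x' f']] /=.
under eq_bigr do rewrite -!mulrA.
rewrite (sum_basis_diag a f (fun c =>
  h x c.2.1 * ((a' == c.1)%:R * ((f' == c.2.2)%:R * h x' c.2.1))^*)) /=.
under eq_bigr do rewrite !rmorphM /= !conjC_nat mulrCA (mulrCA (h x _)).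
rewrite -!mulr_sumr uh -!natrM !mulnb; congr (_%:R); congr nat_of_bool.
rewrite !xpair_eqE /=.
by rewrite [a' == a]eq_sym [f' == f]eq_sym [(x == x') && _]andbC.
Qed.

Lemma target_gateE {C : numClosedFieldType} {d nx} {J : finType} (U : 'M[C]_d)
    (v : 'cV[C]_(d * anc_dim d nx J)) (a : 'I_d) (e : anc_basis d nx J) :
  ((U *t (1%:M : 'M_(anc_dim d nx J))) *m v) (enc (a, e)) 0
  = \sum_a' U a a' * v (enc (a', e)) 0.
Proof.
rewrite mxE; under eq_bigr do rewrite mxE.
have := sum_dec (fun c : basis d nx J => U a c.1 * ((enum_rank e == enum_rank c.2)%:R * v (enc c) 0)).
rewrite (_ : \sum_i _ = \sum_j
  U (mxtens_unindex (enc (a, e))).1 (mxtens_unindex j).1 *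
  (1%:M : 'M_(anc_dim d nx J)) (mxtens_unindex (enc (a, e))).2 (mxtens_unindex j).2 * v j 0).
  move=> ->; rewrite [LHS]sum_prod_finType /=.
  apply: eq_bigr => a' _; rewrite (bigD1 e) //= eqxx mul1r big1 ?addr0 // => e'.
  by rewrite eq_sym (inj_eq enum_rank_inj) => /negbTE ->; rewrite mul0r mulr0.
apply: eq_bigr => j _.
by rewrite decK mxE /enc mxtens_indexK /= enum_valK mulrA.
Qed.

(** The head of [l] is the latest call: the leftmost factor of a product acts last. *)
Definition branch_word {nx} {J : finType} (l : seq (nat * ('I_nx -> J)))
    (x : 'I_nx) (j : J) : seq nat := [seq e.1 | e <- l & e.2 x == j].

(* The amplitudes of the state reached from the basis state [b0] by preparing
   the control register with [h] and performing the calls [l], each one on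
   the register that its slot function selects. *)
Definition branch_amp {C : numClosedFieldType} {d nx} {J : finType}
    (h : 'M[C]_nx) (b0 : basis d nx J) (U : nat -> 'M[C]_d)
    (l : seq (nat * ('I_nx -> J))) (b : basis d nx J) : C :=
  (b.1 == b0.1)%:R * h b.2.1 b0.2.1 *
  \prod_j word_prod U (branch_word l b.2.1 j) (b.2.2 j) (b0.2.2 j).

(** Conjugated by the controlled swap, the call acts in branch [x] on register [e.2 x] and leaves
    the port as it was, so only the factor of that register changes. *)
Lemma branch_amp_step {C : numClosedFieldType} {d nx} {J : finType}
    (h : 'M[C]_nx) (b0 : basis d nx J) (U : nat -> 'M[C]_d) e
    (l : seq (nat * ('I_nx -> J))) (v : 'cV[C]_(d * anc_dim d nx J)) :
  (forall b, v (enc b) 0 = branch_amp h b0 U l b) ->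
  forall b, (perm_gate (swap_reg e.2) *m
    ((U e.1 *t (1%:M : 'M_(anc_dim d nx J))) *m
       (perm_gate (swap_reg e.2) *m v))) (enc b) 0
    = branch_amp h b0 U (e :: l) b.
Proof.
move=> vE [a [x f]]; rewrite perm_gateE /swap_reg /= target_gateE.
under eq_bigr => a' _ do rewrite perm_gateE /swap_reg /= ffunE eqxx vE.
rewrite /branch_amp /= [X in _ = _ * X](bigD1 (e.2 x)) //=.
rewrite {2}/branch_word /= eqxx /= mxE mulr_suml mulr_sumr.
apply: eq_bigr => a' _; rewrite [X in _ * (_ * X) = _](bigD1 (e.2 x)) //= ffunE eqxx.
rewrite (eq_bigr (fun j => word_prod U (branch_word (e :: l) x j) (f j) (b0.2.2 j))); last first.
  move=> j ne_j; rewrite /branch_word /= [e.2 x == j]eq_sym (negbTE ne_j) !ffunE.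
  by rewrite (negbTE ne_j).
rewrite /branch_word; ring.
Qed.

Lemma prod_eq_ffun {R : comNzRingType} {I : finType} {T : eqType}
    (f g : {ffun I -> T}) : \prod_i (f i == g i)%:R = (f == g)%:R :> R.
Proof.
case: eqP => [->|/eqP nfg]; first by apply: big1 => i _; rewrite eqxx.
have [i ni|eqfg] := pickP (fun i => f i != g i).
  by rewrite (bigD1 i) //= (negbTE ni) mul0r.
by case/eqP: nfg; apply/ffunP => i; apply/eqP/negbFE.
Qed.

(** A call is enclosed by two copies of its swap, so the gate between two calls undoes the swap of
    the earlier one and performs that of the later one. After the last call, [h1] takes the place of
    the next swap. *)
Definition branch_fixed {C : numClosedFieldType} {d nx} {J : finType} (j0 : J)
    (h0 h1 : 'M[C]_nx) (l : seq (nat * ('I_nx -> J))) (k : nat) :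
    'M[C]_(d * anc_dim d nx J) :=
  let sw k := perm_gate (swap_reg (nth (0, fun=> j0) (rev l) k).2) in
  let g k := if (k < size l)%N then sw k else ctrl_gate h1 in
  if k is k'.+1 then g k *m sw k' else g 0 *m ctrl_gate h0.

Definition branch_algo {C : numClosedFieldType} {d nx} {J : finType} (j0 : J)
    (h0 h1 : 'M[C]_nx) (out : 'I_nx -> nat) (l : seq (nat * ('I_nx -> J))) :
    causal_algo C d :=
  @CausalAlgo C d (anc_dim d nx J) (size l) (branch_fixed j0 h0 h1 l)
    (fun k => (nth (0, fun=> j0) (rev l) k).1)
    (fun o => out (dec o).2.1).

Lemma branch_algo_valid {C : numClosedFieldType} {d nx n} {J : finType} (j0 : J)
    (h0 h1 : 'M[C]_nx) (out : 'I_nx -> nat) (l : seq (nat * ('I_nx -> J))) :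
  (0 < d)%N -> (0 < nx)%N -> unitarymx h0 -> unitarymx h1 ->
  all (fun e => e.1 < n)%N l -> ca_valid n (branch_algo j0 h0 h1 out l : causal_algo C d).
Proof.
move=> d0 nx0 u0 u1 ltl; split => /=.
- by apply/card_gt0P; exists (Ordinal nx0, [ffun=> Ordinal d0]).
- have usw k : unitarymx (perm_gate (swap_reg (nth (0%N, fun=> j0) (rev l) k).2)
       : 'M[C]_(d * anc_dim d nx J)).
    exact/perm_gate_unitary/inv_inj/swap_regK.
  have ug k : unitarymx (if (k < size l)%N
     then perm_gate (swap_reg (nth (0%N, fun=> j0) (rev l) k).2)
     else ctrl_gate h1 : 'M[C]_(d * anc_dim d nx J)).
    by case: ifP => // _; apply: ctrl_gate_unitary.
  by case=> [|k] _; apply: unitarymxM => //; apply: ctrl_gate_unitary.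
- move=> k ltk; move: ltl; rewrite -all_rev => /(all_nthP (0%N, fun=> j0)).
  by apply; rewrite size_rev.
Qed.

(** [b0] is the basis state of index 0. It is fixed before [h0] because the preparation of the
    control register depends on its initial value [b0.2.1]. *)
Lemma branch_algo_final {C : numClosedFieldType} {d nx} {J : finType} :
  (0 < d)%N -> (0 < nx)%N ->
  exists b0 : basis d nx J, forall j0 (h0 h1 : 'M[C]_nx) out l U a x f,
    ca_final (branch_algo j0 h0 h1 out l) U (enc (a, (x, f))) 0
    = \sum_x' h1 x x' * branch_amp h0 b0 U l (a, (x', f)).
Proof.
move=> d0 nx0.
have anc0 : (0 < d * anc_dim d nx J)%N.
  rewrite muln_gt0 d0; apply/card_gt0P.
  by exists (Ordinal nx0, [ffun=> Ordinal d0]).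
have [b0 b0E] : exists b0, forall c : basis d nx J,
    (ca_init (d * anc_dim d nx J) (enc c) 0 : C) = (c == b0)%:R.
  exists (dec (Ordinal anc0)) => c.
  by rewrite mxE -(can_eq (@encK d nx J)) decK.
exists b0 => j0 h0 h1 out l U a x f.
set A := branch_algo _ _ _ _ _.
pose g k : 'M[C]_(d * anc_dim d nx J) := if (k < size l)%N
     then perm_gate (swap_reg (nth (0%N, fun=> j0) (rev l) k).2)
     else ctrl_gate h1.
(* The invariant concerns the state [v] before [g k], which already performs the swap for the next
   call. *)
have stE k : (k <= size l)%N -> exists2 v : 'cV[C]_(d * anc_dim d nx J),
    ca_state A U k = g k *m v &
    forall b, v (enc b) 0 = branch_amp h0 b0 U (rev (take k (rev l))) b.
  elim: k => [_|k IHk ltk].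
    exists (ctrl_gate h0 *m ca_init _); first by rewrite /= -mulmxA.
    move=> [a' [x' f']]; rewrite ctrl_gateE take0 /branch_amp /=.
    under eq_bigr do rewrite b0E.
    under [X in _ * X]eq_bigr do rewrite mxE.
    case: (b0) => a0 [x0 f0] /=; rewrite (bigD1 x0) //= big1 => [|z /negbTE nz].
      rewrite addr0 prod_eq_ffun !xpair_eqE eqxx /= -mulrA mulrCA.
      by rewrite -natrM mulnb.
    by rewrite !xpair_eqE nz /= andbF mulr0.
  have [v stv vE] := IHk (ltnW ltk).
  set e := nth (0%N, fun=> j0) (rev l) k.
  exists (perm_gate (swap_reg e.2) *m
    ((U e.1 *t (1%:M : 'M_(anc_dim d nx J))) *m
       (perm_gate (swap_reg e.2) *m v))).
    by rewrite /= -/(ca_state A U k) stv /g ltk -!mulmxA.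
  move=> b; rewrite (branch_amp_step h0 b0 _ _ (rev (take k (rev l)))) //.
  by rewrite (take_nth (0%N, fun=> j0)) ?size_rev // rev_rcons.
have [v stv vE] := stE _ (leqnn (size l)).
rewrite /ca_final [ca_len _]/= stv /g ltnn ctrl_gateE.
by apply: eq_bigr => x' _; rewrite vE take_oversize ?size_rev // revK.
Qed.

(** * Execution plans *)

Record hpp_ok (P : hpp) : Prop := HppOk {
  ok_nx : (0 < hpp_nx P)%N;
  ok_size : size (hpp_words P) = hpp_nx P;
  ok_perm : forall x, (x < hpp_nx P)%N ->
    perm_eq (nth [::] (hpp_words P) x) (iota 0 (hpp_n P));
  ok_sign : forall x y, (x < hpp_nx P)%N -> (y < hpp_nx P)%N ->
    hpp_sign P x y * hpp_sign P x y = 1;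
  ok_orth : forall y y', (y < hpp_nx P)%N -> (y' < hpp_nx P)%N ->
    \sum_(x < hpp_nx P) hpp_sign P x y * hpp_sign P x y'
      = ((hpp_nx P * (y == y'))%N)%:Z }.

(* Run [t] carries the call sequence [S t], from which branch [x] uses the
   subsequence [w t x]; run 0 is the one on the heavy path from the root.  In a
   pair [(i, b)], [i] is a gate and [b] marks the occurrence of [i] that ends a
   heavy path.  Problems substituted later for [i] continue this path at the
   marked occurrence and contribute [Pi_0] at the others. *)
Record run_plan (C : numClosedFieldType) (P : hpp) (K : nat)
    (S : nat -> seq (nat * bool)) (w : nat -> nat -> seq (nat * bool)) : Prop :=
  RunPlan {
  rp_lt : forall t e, (t <= K)%N -> e \in S t -> (e.1 < hpp_n P)%N;
  rp_sub : forall t x, (t <= K)%N -> (x < hpp_nx P)%N -> subseq (w t x) (S t);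
  rp_perm : forall t x, (t <= K)%N -> (x < hpp_nx P)%N ->
    perm_eq (w t x) (w t 0);
  rp_crit : forall t x, (t <= K)%N -> (x < hpp_nx P)%N ->
    [seq e <- w t x | e.2] = [seq e <- S t | e.2];
  rp_crit1 : forall i, (i < hpp_n P)%N ->
    (\sum_(t < K.+1) count_mem (i, true) (S t) = 1)%N;
  rp_main : [seq e.1 | e <- w 0 0] = nth [::] (hpp_words P) 0;
  rp_val : forall d (U : nat -> 'M[C]_d) y,
    (forall i, (i < hpp_n P)%N -> unitarymx (U i)) -> (y < hpp_nx P)%N ->
    (forall x, (x < hpp_nx P)%N -> hpp_prod P U x
       = (hpp_sign P x y * hpp_sign P 0 y)%:~R *: hpp_prod P U 0) ->
    exists eps : nat -> nat -> C,
      (forall t x, (t <= K)%N -> (x < hpp_nx P)%N ->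
         word_prod U [seq e.1 | e <- w t x]
         = eps t x *: word_prod U [seq e.1 | e <- w t 0]) /\
      (forall x, (x < hpp_nx P)%N ->
         \prod_(t < K.+1) eps t x = (hpp_sign P x y * hpp_sign P 0 y)%:~R) }.

(** Greedy matching from the head of [S]: branch [x] sends a call to [jt] if it is the next one that
    [w x] awaits, and otherwise to the dummy of its gate. By the third clause, the number of calls
    on a dummy depends on [x] only through the letter counts of [w x]. *)
Lemma run_calls {nx} {J : finType} (jt : J) (jg : nat -> J)
    (S : seq (nat * bool)) (w : 'I_nx -> seq (nat * bool)) :
  (forall i, jg i != jt) -> (forall x, subseq (w x) S) ->
  exists l : seq (nat * ('I_nx -> J)),
    [/\ [seq e.1 | e <- l] = [seq e.1 | e <- S],
        forall x, branch_word l x jt = [seq e.1 | e <- w x],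
        forall x i, (count_mem i (branch_word l x (jg i))
          + count_mem i [seq e.1 | e <- w x] = count_mem i [seq e.1 | e <- S])%N &
        forall x j i, j != jt -> i \in branch_word l x j -> jg i = j].
Proof.
move=> ne_jg; elim: S w => [|s S IHS] w sub_w.
  exists [::]; split => // x; have := sub_w x; rewrite subseq0 => /eqP -> //.
pose b x := if w x is y :: _ then y == s else false.
pose w' x := if b x then behead (w x) else w x.
have [l [l1 l2 l3 l4]] : exists l : seq (nat * ('I_nx -> J)),
    [/\ [seq e.1 | e <- l] = [seq e.1 | e <- S],
        forall x, branch_word l x jt = [seq e.1 | e <- w' x],
        forall x i, (count_mem i (branch_word l x (jg i))
          + count_mem i [seq e.1 | e <- w' x] = count_mem i [seq e.1 | e <- S])%N &
        forall x j i, j != jt -> i \in branch_word l x j -> jg i = j].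
  apply: IHS => x; have := sub_w x; rewrite /w' /b.
  by case: (w x) => [|y v] /=; rewrite ?sub0seq //; case: eqP.
have wE x : w x = if b x then s :: w' x else w' x.
  rewrite /w' /b; case: (w x) => [|y v] //=.
  by case: eqP => //= ->.
exists ((s.1, fun x => if b x then jt else jg s.1) :: l); split => /=.
- by rewrite l1.
- move=> x; rewrite /branch_word /= wE.
  case: (b x); first by rewrite eqxx /= -l2.
  by rewrite (negbTE (ne_jg _)) -l2.
- move=> x i; rewrite /branch_word /= wE -(l3 x).
  case: (b x) => /=.
    rewrite eq_sym (negbTE (ne_jg _)) -/(branch_word l x (jg i)); lia.
  case: (eqVneq s.1 i) => [->|ne_si].
    by rewrite eqxx /= eqxx -/(branch_word l x (jg i)); lia.
  case: (jg s.1 == jg i) => /=; rewrite -/(branch_word l x (jg i)) ?(negbTE ne_si) /=; lia.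
- move=> x j i nj; rewrite /branch_word /=.
  case: (b x) => /=; first by rewrite eq_sym (negbTE nj); apply: l4.
  case: eqP => [<-|_] /=; last exact: l4.
  rewrite in_cons => /orP[/eqP -> //|].
  exact: l4.
Qed.

Lemma branch_word_flatten {nx} {J : finType} {T : Type}
    (l : T -> seq (nat * ('I_nx -> J))) (s : seq T) x j :
  branch_word (flatten [seq l t | t <- s]) x j
  = flatten [seq branch_word (l t) x j | t <- s].
Proof.
elim: s => //= t s IHs; rewrite -IHs /branch_word.
by rewrite filter_cat map_cat.
Qed.

Lemma flatten_single {T : eqType} {V : Type} (s : seq T) (t : T) (F : T -> seq V) :
  uniq s -> t \in s -> (forall t', t' != t -> F t' = [::]) ->
  flatten [seq F t' | t' <- s] = F t.
Proof.
move=> us ts F0; elim: s us ts => //= u s IHs /andP[us uniqs].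
rewrite in_cons => /orP[/eqP eq_tu|ts]; last first.
  rewrite IHs // F0 //; apply: contraNneq us => -> //.
rewrite -eq_tu (_ : flatten _ = [::]) ?cats0 //.
have : t \notin s by rewrite eq_tu.
elim: s {IHs us uniqs} => //= v s IHs; rewrite in_cons negb_or => /andP[tv ts].
by rewrite F0 1?eq_sym // IHs.
Qed.

Lemma eq_constant_count {T : eqType} (c : T) (s1 s2 : seq T) :
  all (pred1 c) s1 -> all (pred1 c) s2 ->
  count_mem c s1 = count_mem c s2 -> s1 = s2.
Proof.
move=> a1 a2; have := a1; have := a2; rewrite !all_count => /eqP -> /eqP -> eqs.
by move/all_pred1P: a1 => ->; move/all_pred1P: a2 => ->; rewrite eqs.
Qed.

Lemma branch_word_sub {nx} {J : finType} (l : seq (nat * ('I_nx -> J))) x j :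
  {subset branch_word l x j <= [seq e.1 | e <- l]}.
Proof.
move=> i; elim: l => //= e l IHl; rewrite /branch_word /= in_cons.
case: ifP => _ /=; rewrite ?in_cons; last by move/IHl ->; rewrite orbT.
by case/orP => [-> //|/IHl ->]; rewrite orbT.
Qed.

(** A dummy sees only copies of its own gate, so its word is determined by its length. This length
    is the same in all branches because the words [w t x], for fixed [t], are permutations of one
    another. *)
Lemma run_plan_calls {C P K S w} : run_plan C P K S w -> (0 < hpp_nx P)%N ->
  exists n' : nat, exists l : seq (nat * ('I_(hpp_nx P) -> 'I_K.+1 + 'I_n'.+1)),
  [/\ all (fun e => e.1 < hpp_n P)%N l,
      size l = (\sum_(t < K.+1) size (S t))%N,
      forall x t, branch_word l x (inl t) = [seq e.1 | e <- w t x] &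
      forall x x' c, branch_word l x (inr c) = branch_word l x' (inr c)].
Proof.
(* There is one dummy more than gates, so that [inord] is available even without gates. *)
move=> plan nx0; exists (hpp_n P).
pose J : finType := ('I_K.+1 + 'I_(hpp_n P).+1)%type.
pose jg i : J := inr (inord i).
have ltK (t : 'I_K.+1) : (t <= K)%N by rewrite -ltnS.
have /fin_all_exists[l lP] (t : 'I_K.+1) :=
  @run_calls (hpp_nx P) J (inl t) jg (S t) (fun x => w t x) (fun=> isT)
    (fun x => rp_sub _ _ _ _ _ plan t x (ltK t) (ltn_ord x)).
have lt_l t x j i : i \in branch_word (l t) x j -> (i < hpp_n P)%N.
  have [l1 _ _ _] := lP t => i_in.
  have : i \in [seq e.1 | e <- l t].
    exact: branch_word_sub i_in.
  by rewrite l1 => /mapP[e eS ->]; apply: (rp_lt _ _ _ _ _ plan t).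
exists (flatten [seq l t | t <- enum 'I_K.+1]); split.
- elim: (enum _) => //= t s IHs; rewrite all_cat IHs andbT.
  have [l1 _ _ _] := lP t.
  rewrite -(all_map fst (fun i => i < hpp_n P)%N) l1 all_map.
  apply/allP => e eS; exact: (rp_lt _ _ _ _ _ plan t).
- rewrite size_flatten /shape -map_comp sumnE big_map big_enum /=.
  apply: eq_bigr => t _; have [l1 _ _ _] := lP t.
  by rewrite -(size_map fst) l1 size_map.
- move=> x t; rewrite branch_word_flatten (flatten_single _ t) ?enum_uniq ?mem_enum //.
    by have [_ -> _ _] := lP t.
  move=> t' ne_t; have [_ _ _ l4] := lP t'.
  case bwE: (branch_word _ _ _) => [|i s] //.
  have /l4 : i \in branch_word (l t') x (inl t) by rewrite bwE mem_head.
  by rewrite (inj_eq (@inl_inj _ _)) eq_sym => /(_ ne_t).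
- have all_c (c : 'I_(hpp_n P).+1) x :
      all (pred1 (c : nat)) (branch_word (flatten [seq l t | t <- enum 'I_K.+1]) x (inr c)).
    apply/allP => i; rewrite branch_word_flatten => /flattenP[s /mapP[t _ ->] i_in].
    have [_ _ _ l4] := lP t; have [eq_c] : jg i = inr c by apply: l4 i_in.
    by rewrite /= -eq_c inordK // ltnW // ltnS (lt_l _ _ _ _ i_in).
  move=> x x' c; apply: (eq_constant_count (c : nat)) => //.
  rewrite !branch_word_flatten !count_flatten -!map_comp; congr sumn.
  apply: eq_map => t /=; have [_ _ l3 _] := lP t.
  have cE : inr c = jg c by rewrite /jg inord_val.
  have /permP eq_cnt : perm_eq [seq e.1 | e <- w t x] [seq e.1 | e <- w t x'].
    apply: perm_map; apply: perm_trans (rp_perm _ _ _ _ _ plan _ _ (ltK t) (ltn_ord x)) _.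
    by rewrite perm_sym (rp_perm _ _ _ _ _ plan _ _ (ltK t) (ltn_ord x')).
  apply/eqP; rewrite cE -(eqn_add2r (count_mem (c : nat) [seq e.1 | e <- w t x])) l3.
  by rewrite eq_cnt l3.
Qed.

(** * Transforms of the control register, and the algorithm of a plan *)

Definition hadamard_mx (C : numClosedFieldType) (P : hpp) : 'M[C]_(hpp_nx P) :=
  \matrix_(y, x) ((sqrtC (hpp_nx P)%:R)^-1 * (hpp_sign P x y)%:~R).

(* Maps the basis state [x0] to the uniform superposition. *)
Definition prep_mx (C : numClosedFieldType) (P : hpp) (x0 : 'I_(hpp_nx P)) :
    'M[C]_(hpp_nx P) :=
  \matrix_(x, y) ((sqrtC (hpp_nx P)%:R)^-1
                  * (hpp_sign P x y * hpp_sign P x x0)%:~R).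

Lemma conj_invsqrtC_nat (C : numClosedFieldType) n :
  ((sqrtC n%:R)^-1)^* = (sqrtC n%:R)^-1 :> C.
Proof. by rewrite geC0_conj // invr_ge0 sqrtC_ge0 ler0n. Qed.

Lemma invsqrtC_nat_sqr (C : numClosedFieldType) n : (0 < n)%N ->
  (sqrtC n%:R)^-1 * (sqrtC n%:R)^-1 * n%:R = 1 :> C.
Proof.
move=> n0; rewrite -expr2 exprVn sqrtCK mulVf //.
by rewrite pnatr_eq0 -lt0n.
Qed.

Lemma hadamard_unitary (C : numClosedFieldType) P :
  hpp_ok P -> unitarymx (hadamard_mx C P).
Proof.
case=> nx0 _ _ _ orth; apply/unitary_rowsP => y y'.
under eq_bigr => x _ do rewrite !mxE rmorphM /= conj_invsqrtC_nat rmorph_int mulrACA -intrM.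
rewrite -mulr_sumr -rmorph_sum /= orth // -pmulrn natrM mulrA.
by rewrite invsqrtC_nat_sqr // mul1r.
Qed.

(** This is the adjoint of the Hadamard transform with row [x] multiplied by the sign [s(x,x0)]. *)
Lemma prep_unitary (C : numClosedFieldType) P x0 :
  hpp_ok P -> unitarymx (prep_mx C P x0).
Proof.
move=> okP; have [nx0 _ _ sgn _] := okP.
have uH := iffLR (unitary_rowsP _) (unitarymx_adj _ (hadamard_unitary C P okP)).
apply/unitary_rowsP => x z; have := uH x z.
under eq_bigr do rewrite !mxE !rmorphM /= !conj_invsqrtC_nat !rmorph_int.
under [in X in _ -> X]eq_bigr do rewrite !mxE !rmorphM /= !conj_invsqrtC_nat !rmorph_int.
move=> sumE; pose g z : C := (hpp_sign P z x0)%:~R.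
transitivity (g x * g z * (x == z)%:R : C).
  by rewrite -sumE mulr_sumr; apply: eq_bigr => y _; rewrite /g; ring.
by case: eqP => [->|_]; rewrite ?mulr0 // /g -intrM sgn // mulr1.
Qed.

(** The amplitude of branch [z] is [s(z,y) s(0,y)] times a quantity [T] free of [z]. After the
    Hadamard transform, the amplitude at control value [x] contains the inner product of columns [x]
    and [y] of [s], which vanishes unless [x = y]. *)
Lemma run_plan_solves (C : numClosedFieldType) P K S w d :
  hpp_ok P -> run_plan C P K S w -> (0 < d)%N ->
  exists A : causal_algo C d,
    [/\ ca_valid (hpp_n P) A, ca_solves P A &
        ca_queries A = (\sum_(t < K.+1) size (S t))%N].
Proof.
move=> okP plan d0; have [nx0 szW _ sgn orth] := okP.
have [n' [l [ltl szl lw lg]]] := run_plan_calls plan nx0.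
pose J : finType := ('I_K.+1 + 'I_n'.+1)%type.
have [b0 finalE] := @branch_algo_final C d (hpp_nx P) J d0 nx0.
pose j0 : J := inl ord0.
exists (branch_algo j0 (prep_mx C P b0.2.1) (hadamard_mx C P) (@nat_of_ord _) l); split.
- by apply: branch_algo_valid => //; [apply: prep_unitary|apply: hadamard_unitary].
- move=> U y uU [ylt prom] o; rewrite -(decK o); case: (dec o) => a [x f].
  rewrite finalE /ca_out /branch_algo encK /=; apply: contraNeq => ne_xy.
  (* The promise at 0 reads [Pi_0 = s(0,y) Pi_0], so a factor [s(0,y)] can be inserted. This
     relative form is the one that a composition passes on to both of its parts. *)
  have gprom z : (z < hpp_nx P)%N ->
      hpp_prod P U z = (hpp_sign P z y * hpp_sign P 0 y)%:~R *: hpp_prod P U 0.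
    move=> zlt; rewrite rmorphM /= -scalerA -prom //; exact: prom.
  have [eps [epsE epsP]] := rp_val _ _ _ _ _ plan _ _ _ uU ylt gprom.
  pose x1 : 'I_(hpp_nx P) := Ordinal nx0.
  pose T : C := (a == b0.1)%:R * (sqrtC (hpp_nx P)%:R)^-1 *
    ((\prod_(t < K.+1) word_prod U [seq e.1 | e <- w t 0] (f (inl t)) (b0.2.2 (inl t)))
     * (\prod_(c < n'.+1) word_prod U (branch_word l x1 (inr c)) (f (inr c)) (b0.2.2 (inr c)))).
  have ampE z : branch_amp (prep_mx C P b0.2.1) b0 U l (a, (z, f))
      = (hpp_sign P z y * hpp_sign P 0 y)%:~R * T.
    rewrite /branch_amp /= mxE sgn // mulr1 big_sumType /= /T.
    under eq_bigr => t _ do rewrite lw (epsE _ _ (ltn_ord t) (ltn_ord z)) mxE.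
    rewrite big_split /= epsP //.
    under [X in _ * (_ * X)]eq_bigr => c _ do rewrite (lg z x1).
    ring.
  apply/eqP; rewrite (eq_bigr (fun z : 'I_(hpp_nx P) => (sqrtC (hpp_nx P)%:R)^-1 *
    (hpp_sign P 0 y)%:~R * T * (hpp_sign P z x * hpp_sign P z y)%:~R)); last first.
    by move=> z _; rewrite ampE !mxE !intrM; ring.
  by rewrite -mulr_sumr -rmorph_sum /= orth // (negbTE ne_xy) muln0 mulr0.
- by rewrite /ca_queries /= szl.
Qed.

(** * Substituting a problem for a gate *)

Lemma word_prod_cat {C : pzRingType} {d} (U : nat -> 'M[C]_d) s1 s2 :
  word_prod U (s1 ++ s2) = word_prod U s1 *m word_prod U s2.
Proof.
by elim: s1 => [|i s1 IHs] /=; rewrite ?mul1mx // IHs mulmxA.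
Qed.

Lemma word_prod_map {C : pzRingType} {d} (U : nat -> 'M[C]_d) f s :
  word_prod U (map f s) = word_prod (fun i => U (f i)) s.
Proof. by elim: s => //= i s ->. Qed.

Lemma eq_in_word_prod {C : pzRingType} {d} (U V : nat -> 'M[C]_d) s :
  {in s, U =1 V} -> word_prod U s = word_prod V s.
Proof.
elim: s => //= i s IHs eqUV; rewrite eqUV ?mem_head // IHs // => j js.
by apply: eqUV; rewrite in_cons js orbT.
Qed.

Lemma word_prod_unitary {C : numClosedFieldType} {d} (U : nat -> 'M[C]_d) s :
  (forall i, i \in s -> unitarymx (U i)) -> unitarymx (word_prod U s).
Proof.
elim: s => [|i s IHs] uU /=; first exact: unitarymx1.
apply: unitarymxM; first by apply: uU; rewrite mem_head.
by apply: IHs => j js; apply: uU; rewrite in_cons js orbT.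
Qed.

(** Pulls an assignment for the gates of a composition back to the outer problem. It serves for
    matrices and, in the query count, for weights. *)
Definition subst_gate {T} (g : nat) (M : T) (U : nat -> T) (i : nat) : T :=
  if i == g then M else U (comp_relabel g i).

Lemma word_prod_comp {C : pzRingType} {d} P g (U : nat -> 'M[C]_d) w1 w2 :
  word_prod U (comp_word P g w1 w2)
  = word_prod (subst_gate g
      (word_prod (fun j => U ((hpp_n P).-1 + j)%N) w2) U) w1.
Proof.
elim: w1 => //= i w1 IHw; rewrite -/(comp_word P g w1 w2).
rewrite word_prod_cat IHw /subst_gate; case: eqP => _ /=.
  by rewrite word_prod_map.
by rewrite mulmx1.
Qed.

(** As [g] occurs exactly once, the word splits around it into unitary factors, which cancel. This
    extracts the promise of an inner problem from that of a composition. *)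
Lemma subst_gate_cancel {C : numClosedFieldType} {d} g (U : nat -> 'M[C]_d)
    (M N : 'M[C]_d) c w :
  g \in w -> uniq w ->
  (forall i, i \in w -> i != g -> unitarymx (U (comp_relabel g i))) ->
  word_prod (subst_gate g M U) w = c *: word_prod (subst_gate g N U) w ->
  M = c *: N.
Proof.
move=> gw uw uU; case/splitPr: gw uw uU => a b.
rewrite cat_uniq /= negb_or => /and4P[_ /andP[ga _] gb _] uU.
have off s : g \notin s ->
    word_prod (subst_gate g M U) s = word_prod (subst_gate g N U) s.
  move=> gs; apply: eq_in_word_prod => i i_s; rewrite /subst_gate.
  by case: eqP => // ig; rewrite -ig i_s in gs.
have us s : g \notin s -> {subset s <= a ++ g :: b} ->
    unitarymx (word_prod (subst_gate g N U) s).
  move=> gs sub; apply: word_prod_unitary => i i_s; rewrite /subst_gate.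
  have ne_ig : i != g by apply: contraNneq gs => <-.
  by rewrite (negbTE ne_ig); apply: uU => //; apply: sub.
have sg X : subst_gate g X U g = X by rewrite /subst_gate eqxx.
rewrite !word_prod_cat /= !sg !off // scalemxAr => eqM.
have {}eqM := unitarymx_lreg _ _ _ (us a ga _) eqM.
apply: (unitarymx_rreg (word_prod (subst_gate g N U) b)).
  by apply: us => // i ib; rewrite mem_cat in_cons ib !orbT.
rewrite eqM -?scalemxAl // => i ia; by rewrite mem_cat ia.
Qed.

Definition shift_run (k : nat) (s : seq (nat * bool)) : seq (nat * bool) :=
  [seq (k + e.1, e.2)%N | e <- s].

(** In use, [A] is a run of the inner problem that continues the heavy path, and [B] is its product
    [Pi_0]. *)
Definition subst_run (g : nat) (A B s : seq (nat * bool)) : seq (nat * bool) :=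
  flatten [seq (if e.1 == g then if e.2 then A else B
                else [:: (comp_relabel g e.1, e.2)]) | e <- s].

Lemma subseq_flatten_map {T V : eqType} (f f' : T -> seq V) s s' :
  (forall e, subseq (f e) (f' e)) -> subseq s s' ->
  subseq (flatten [seq f e | e <- s]) (flatten [seq f' e | e <- s']).
Proof.
move=> sub_f; elim: s' s => [|e s' IHs] [|a s] //=; first by rewrite sub0seq.
case: eqP => [->|_] sub_s; first by apply: cat_subseq => //; apply: IHs.
exact: subseq_trans (IHs _ sub_s) (suffix_subseq _ _).
Qed.

Lemma perm_flatten_map {T V : eqType} (f f' : T -> seq V) s s' :
  (forall e, perm_eq (f e) (f' e)) -> perm_eq s s' ->
  perm_eq (flatten [seq f e | e <- s]) (flatten [seq f' e | e <- s']).
Proof.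
move=> perm_f /(perm_map f)/perm_flatten/perm_trans; apply.
by elim: s' => //= e s' IHs; apply: perm_cat.
Qed.

Lemma subst_run_sub g A A' B s s' :
  subseq A A' -> subseq s s' -> subseq (subst_run g A B s) (subst_run g A' B s').
Proof.
move=> sA; apply: subseq_flatten_map => e.
by case: ifP => // _; case: ifP.
Qed.

Lemma subst_run_perm g A A' B s s' :
  perm_eq A A' -> perm_eq s s' ->
  perm_eq (subst_run g A B s) (subst_run g A' B s').
Proof.
move=> pA; apply: perm_flatten_map => e.
by case: ifP => // _; case: ifP.
Qed.

Lemma subst_run_crit g A A' B s s' : all (fun e => ~~ e.2) B ->
  [seq e <- A | e.2] = [seq e <- A' | e.2] ->
  [seq e <- s | e.2] = [seq e <- s' | e.2] ->
  [seq e <- subst_run g A B s | e.2] = [seq e <- subst_run g A' B s' | e.2].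
Proof.
move=> /allP critB eqA eqs.
(* Selecting the marked calls commutes with substitution; [B], which has none, becomes empty. *)
have normal A'' s'' : [seq e <- subst_run g A'' B s'' | e.2]
    = subst_run g [seq e <- A'' | e.2] [::] [seq e <- s'' | e.2].
  elim: s'' => //= -[i b] s'' IHs; rewrite /subst_run /= -/(subst_run _ _ _ _).
  rewrite filter_cat IHs; case: b => /=.
    by rewrite /subst_run /=; case: ifP.
  case: ifP => // _; suff -> : [seq e <- B | e.2] = [::] by [].
  by apply/eqP; rewrite -(negbK (_ == _)) -has_filter; apply/hasPn.
by rewrite !normal eqA eqs.
Qed.

Lemma subst_run_word P g A B s w2 :
  [seq e.1 | e <- A] = [seq ((hpp_n P).-1 + j)%N | j <- w2] ->
  [seq e.1 | e <- B] = [seq ((hpp_n P).-1 + j)%N | j <- w2] ->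
  [seq e.1 | e <- subst_run g A B s] = comp_word P g [seq e.1 | e <- s] w2.
Proof.
move=> eqA eqB; elim: s => //= e s IHs.
rewrite /subst_run /comp_word /= map_cat -/(subst_run g A B s) IHs.
by congr (_ ++ _); case: ifP => // _; case: ifP.
Qed.

Lemma subst_run_val {C : fieldType} {d} g (U : nat -> 'M[C]_d) A B s c M :
  word_prod U [seq e.1 | e <- A] = c *: M ->
  word_prod U [seq e.1 | e <- B] = M ->
  word_prod U [seq e.1 | e <- subst_run g A B s]
  = c ^+ count_mem (g, true) s *: word_prod (subst_gate g M U) [seq e.1 | e <- s].
Proof.
move=> eqA eqB; elim: s => [|[i b] s IHs] /=; first by rewrite expr0 scale1r.
rewrite /subst_run /= map_cat -/(subst_run g A B s) word_prod_cat IHs.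
rewrite /subst_gate xpair_eqE eqb_id -/(subst_gate g M U).
case: ifP => _ /=; last by rewrite mulmx1 -scalemxAr.
case: b; rewrite ?eqA ?eqB -?scalemxAl -scalemxAr //.
by rewrite scalerA exprS.
Qed.

(** [m i] is the weight of what will later replace gate [i]. Marked calls are free, since a problem
    substituted there is charged through its own runs. *)
Definition run_weight (m : nat -> nat) (s : seq (nat * bool)) : nat :=
  \sum_(e <- s | ~~ e.2) m e.1.

Lemma subst_run_weight g A B s m :
  run_weight m (subst_run g A B s)
  = (run_weight (subst_gate g (run_weight m B) m) s
     + count_mem (g, true) s * run_weight m A)%N.
Proof.
rewrite /run_weight; elim: s => [|[i b] s IHs]; first by rewrite /subst_run /= !big_nil.
rewrite /subst_run /= big_cat -/(subst_run g A B s) IHs big_cons /=.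
rewrite xpair_eqE eqb_id /subst_gate; case: eqP => _ /=.
  by case: b; rewrite /= ?mulnDl ?mul1n; lia.
by rewrite big_cons big_nil /=; case: b; rewrite /= ?addn0; lia.
Qed.

Lemma subst_run_count_old g A B s n i :
  (forall e, e \in A -> n <= e.1)%N -> (forall e, e \in B -> n <= e.1)%N ->
  (i < n)%N ->
  count_mem (i, true) (subst_run g A B s)
  = count_mem (if i < g then i else i.+1, true)%N s.
Proof.
move=> nA nB lin; elim: s => [|[j b] s IHs] //=.
rewrite /subst_run /= count_cat -/(subst_run g A B s) IHs; congr (_ + _)%N.
have c0 D : (forall e, e \in D -> n <= e.1)%N -> count_mem (i, true) D = 0%N.
  move=> nD; apply/count_memPn/negP => /nD /=; lia.
rewrite xpair_eqE eqb_id /comp_relabel; case: (eqVneq j g) => [->|ne_jg] /=.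
  have -> : (g == (if i < g then i else i.+1))%N = false by case: ifP; lia.
  by case: b; rewrite c0.
rewrite xpair_eqE eqb_id addn0; congr (nat_of_bool (_ && b)).
by case: (ltnP j g); case: (ltnP i g); move: ne_jg; lia.
Qed.

Lemma subst_run_count_new g A B s n i :
  all (fun e => ~~ e.2) B -> (g <= n)%N ->
  (forall e, e \in s -> e.1 <= n)%N -> (n <= i)%N ->
  count_mem (i, true) (subst_run g A B s)
  = (count_mem (g, true) s * count_mem (i, true) A)%N.
Proof.
move=> /allP critB gn; elim: s => [|[j b] s IHs] //= sn ni.
rewrite /subst_run /= count_cat -/(subst_run g A B s) IHs //; last first.
  by move=> e es; apply: sn; rewrite in_cons es orbT.
rewrite xpair_eqE eqb_id mulnDl; congr (_ + _)%N.
have {sn IHs} : (j <= n)%N := sn (j, b) (mem_head _ _).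
rewrite /comp_relabel; case: (eqVneq j g) => [->|ne_jg] /= jn.
  case: b => /=; first by rewrite mul1n.
  by apply/count_memPn/negP => /critB.
rewrite xpair_eqE addn0 mul0n; apply/eqP; rewrite eqb0; apply/negP => /andP[+ _].
by case: (ltnP j g); move: ne_jg; lia.
Qed.

Lemma nth_allpairs {S T R : Type} (f : S -> T -> R) s t i j x0 y0 z0 :
  (i < size s)%N -> (j < size t)%N ->
  nth z0 [seq f x y | x <- s, y <- t] (i * size t + j) = f (nth x0 s i) (nth y0 t j).
Proof.
elim: s i => //= x s IHs [|i] lti ltj; rewrite nth_cat size_map.
  by rewrite ltj (nth_map y0).
rewrite ltnNge (_ : size t <= _)%N /=; last by rewrite mulSn -addnA leq_addr.
by rewrite mulSn -addnA addKn IHs.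
Qed.

(** * Words, sign matrix and promise of a composition *)

Lemma comp_word_perm P Q g w1 w2 : (g < hpp_n P)%N ->
  perm_eq w1 (iota 0 (hpp_n P)) -> perm_eq w2 (iota 0 (hpp_n Q)) ->
  perm_eq (comp_word P g w1 w2) (iota 0 (hpp_n (hpp_comp P Q g))).
Proof.
move=> gP p1 p2.
(* Permuting either word only permutes the composed one, so both may be taken sorted. *)
apply: (@perm_trans _ (comp_word P g (iota 0 (hpp_n P)) (iota 0 (hpp_n Q)))).
  apply: perm_flatten_map => // i; case: ifP => // _; exact: perm_map.
have -> : hpp_n P = (g + (1 + ((hpp_n P).-1 - g)))%N by lia.
set r := ((hpp_n P).-1 - g)%N.
have wE s : g \notin s -> comp_word P g s (iota 0 (hpp_n Q))
    = [seq comp_relabel g i | i <- s].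
  rewrite /comp_word; elim: s => //= i s IHs; rewrite in_cons negb_or => /andP[gi /IHs ->].
  by rewrite eq_sym (negbTE gi).
have catE s t : comp_word P g (s ++ t) (iota 0 (hpp_n Q))
   = comp_word P g s (iota 0 (hpp_n Q)) ++ comp_word P g t (iota 0 (hpp_n Q)).
  by rewrite /comp_word map_cat flatten_cat.
rewrite iotaD catE add0n iotaD catE (wE (iota 0 g)) ?(wE (iota (g + 1) r)) ?mem_iota; [|lia|lia].
rewrite {1}/comp_word /= eqxx cats0.
have -> : [seq comp_relabel g i | i <- iota 0 g] = iota 0 g.
  rewrite -[RHS]map_id; apply/eq_in_map => i; rewrite mem_iota /comp_relabel.
  by move=> ?; rewrite ifT //; lia.
have -> : [seq comp_relabel g i | i <- iota (g + 1) r] = iota g r.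
  rewrite -(addn0 g) [in RHS]iotaDl [in LHS]addnAC iotaDl -map_comp.
  rewrite addn0; apply/eq_in_map => i; rewrite mem_iota /comp_relabel /= => ?.
  rewrite ifF; lia.
have -> : (hpp_n P + hpp_n Q).-1 = (g + (r + hpp_n Q))%N by rewrite /r; lia.
rewrite iotaD perm_cat2l iotaD perm_catC perm_cat2l add0n.
rewrite -iotaDl addn0.
by have -> : (hpp_n P).-1 = (g + r)%N by rewrite /r; lia.
Qed.

Lemma comp_nth_word P Q g x1 x2 : hpp_ok P -> hpp_ok Q ->
  (x1 < hpp_nx P)%N -> (x2 < hpp_nx Q)%N ->
  nth [::] (hpp_words (hpp_comp P Q g)) (x1 * hpp_nx Q + x2)
  = comp_word P g (nth [::] (hpp_words P) x1) (nth [::] (hpp_words Q) x2).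
Proof.
move=> okP okQ lt1 lt2; rewrite -(ok_size _ okQ).
by rewrite (nth_allpairs _ _ _ _ _ [::] [::]) ?ok_size.
Qed.

Lemma ltn_divmod {m n x} : (x < m * n)%N -> (x %/ n < m)%N /\ (x %% n < n)%N.
Proof.
case: n => [|n]; first by rewrite muln0.
by move=> lt_x; rewrite ltn_divLR // ltn_mod.
Qed.

Lemma hpp_comp_ok P Q g : (g < hpp_n P)%N -> hpp_ok P -> hpp_ok Q ->
  hpp_ok (hpp_comp P Q g).
Proof.
move=> gP okP okQ; split => /=.
- by rewrite muln_gt0 !ok_nx.
- by rewrite size_allpairs !ok_size.
- move=> x /ltn_divmod[lt1 lt2].
  rewrite {1}(divn_eq x (hpp_nx Q)) comp_nth_word //.
  by apply: comp_word_perm => //; apply: ok_perm.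
- move=> x y /ltn_divmod[x1 x2] /ltn_divmod[y1 y2].
  by rewrite mulrACA !ok_sign.
- move=> y y' lty lty'; have [y1 y2] := ltn_divmod lty.
  have [z1 z2] := ltn_divmod lty'.
  (* The sign matrix is a Kronecker product, so the sum over pairs factors. *)
  transitivity ((\sum_(x < hpp_nx P) hpp_sign P x (y %/ hpp_nx Q) * hpp_sign P x (y' %/ hpp_nx Q))
    * (\sum_(x < hpp_nx Q) hpp_sign Q x (y %% hpp_nx Q) * hpp_sign Q x (y' %% hpp_nx Q))).
    rewrite mulr_sum; apply: eq_bigr => x _ /=; exact: mulrACA.
  rewrite !ok_orth // -PoszM mulnACA mulnb; congr (Posz (_ * nat_of_bool _)).
  apply/andP/eqP => [[/eqP e1 /eqP e2]|-> //].
  by rewrite (divn_eq y (hpp_nx Q)) e1 e2 -divn_eq.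
Qed.

Lemma subst_gate_unitary {C : numClosedFieldType} {d} P Q g (U : nat -> 'M[C]_d) M i :
  (g < hpp_n P)%N -> unitarymx M ->
  (forall j, (j < hpp_n (hpp_comp P Q g))%N -> unitarymx (U j)) ->
  (i < hpp_n P)%N -> unitarymx (subst_gate g M U i).
Proof.
move=> gP uM uU iP; rewrite /subst_gate; case: eqVneq => // ne_ig.
apply: uU; rewrite /= /comp_relabel; case: ifP; move: ne_ig; lia.
Qed.

(** Taking [x2 = 0] gives the relation for [P], with [Pi_0] of [Q] as gate [g]; taking [x1 = 0] and
    cancelling the surrounding unitaries gives the one for [Q]. The sign of the other problem occurs
    squared. *)
Lemma run_plan_comp_val {C : numClosedFieldType} {P Q g d} {U : nat -> 'M[C]_d} {y} :
  hpp_ok P -> hpp_ok Q -> (g < hpp_n P)%N ->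
  (forall i, (i < hpp_n (hpp_comp P Q g))%N -> unitarymx (U i)) ->
  (y < hpp_nx P * hpp_nx Q)%N ->
  (forall x, (x < hpp_nx P * hpp_nx Q)%N -> hpp_prod (hpp_comp P Q g) U x
     = (hpp_sign (hpp_comp P Q g) x y * hpp_sign (hpp_comp P Q g) 0 y)%:~R
       *: hpp_prod (hpp_comp P Q g) U 0) ->
  let UQ j := U ((hpp_n P).-1 + j)%N in
  let UP := subst_gate g (hpp_prod Q UQ 0) U in
  [/\ forall i, (i < hpp_n Q)%N -> unitarymx (UQ i),
      forall i, (i < hpp_n P)%N -> unitarymx (UP i),
      forall x, (x < hpp_nx Q)%N -> hpp_prod Q UQ x
        = (hpp_sign Q x (y %% hpp_nx Q) * hpp_sign Q 0 (y %% hpp_nx Q))%:~R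
          *: hpp_prod Q UQ 0 &
      forall x, (x < hpp_nx P)%N -> hpp_prod P UP x
        = (hpp_sign P x (y %/ hpp_nx Q) * hpp_sign P 0 (y %/ hpp_nx Q))%:~R
          *: hpp_prod P UP 0].
Proof.
move=> okP okQ gP uU ylt prom UQ UP.
have [y1 y2] := ltn_divmod ylt.
have uUQ i : (i < hpp_n Q)%N -> unitarymx (UQ i).
  by move=> iQ; apply: uU => /=; lia.
have uq x : (x < hpp_nx Q)%N -> unitarymx (hpp_prod Q UQ x).
  move=> xQ; apply: word_prod_unitary => i.
  by rewrite (perm_mem (ok_perm _ okQ _ xQ)) mem_iota => /uUQ.
have {}prom x1 x2 : (x1 < hpp_nx P)%N -> (x2 < hpp_nx Q)%N ->
    hpp_prod P (subst_gate g (hpp_prod Q UQ x2) U) x1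
    = (hpp_sign P x1 (y %/ hpp_nx Q) * hpp_sign Q x2 (y %% hpp_nx Q)
       * (hpp_sign P 0 (y %/ hpp_nx Q) * hpp_sign Q 0 (y %% hpp_nx Q)))%:~R
      *: hpp_prod P UP 0.
  move=> lt1 lt2; have /prom : (x1 * hpp_nx Q + x2 < hpp_nx P * hpp_nx Q)%N.
    by move: lt1 lt2; nia.
  rewrite /hpp_prod comp_nth_word //.
  rewrite -{2}[0%N]/(0 * hpp_nx Q + 0)%N comp_nth_word ?ok_nx // !word_prod_comp => -> /=.
  by rewrite divnMDl ?ok_nx // modnMDl divn_small // modn_small // addn0 div0n mod0n.
split => //.
- move=> i; apply: (subst_gate_unitary P Q) => //.
  exact: uq (ok_nx _ okQ).
- move=> x xQ; have perm0 := ok_perm _ okP _ (ok_nx _ okP).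
  apply: (@subst_gate_cancel C d g U _ _ _ (nth [::] (hpp_words P) 0)).
  + by rewrite (perm_mem perm0) mem_iota.
  + by rewrite (perm_uniq perm0) iota_uniq.
  + move=> i; rewrite (perm_mem perm0) mem_iota => /= iP ne_ig.
    have := subst_gate_unitary P Q g U 1%:M i gP unitarymx1 uU iP.
    by rewrite /subst_gate (negbTE ne_ig).
  rewrite -/(hpp_prod P _ 0) prom ?ok_nx //.
  congr (_%:~R *: _); rewrite mulrACA ok_sign ?ok_nx // mul1r //.
- move=> x xP; rewrite prom ?ok_nx //; congr (_%:~R *: _).
  by rewrite mulrACA ok_sign ?ok_nx // mulr1.
Qed.

(** Run 0 of [Q] is spliced into the run of [P] that holds the marked [g]; its runs from 1 on are
    appended after run [KP]. *)
Definition comp_S (P Q : hpp) (g KP : nat) (SP SQ : nat -> seq (nat * bool)) (t : nat) :=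
  let k := (hpp_n P).-1 in
  if (t <= KP)%N then
    subst_run g (shift_run k (SQ 0))
      [seq (k + j, false)%N | j <- nth [::] (hpp_words Q) 0] (SP t)
  else shift_run k (SQ (t - KP)%N).

Definition comp_w (P Q : hpp) (g KP : nat) (wP wQ : nat -> nat -> seq (nat * bool)) (t x : nat) :=
  let k := (hpp_n P).-1 in
  if (t <= KP)%N then
    subst_run g (shift_run k (wQ 0 (x %% hpp_nx Q)%N))
      [seq (k + j, false)%N | j <- nth [::] (hpp_words Q) 0]
      (wP t (x %/ hpp_nx Q)%N)
  else shift_run k (wQ (t - KP)%N (x %% hpp_nx Q)%N).

Lemma shift_runE k s : [seq e.1 | e <- shift_run k s] = [seq (k + e.1)%N | e <- s].
Proof. by rewrite /shift_run -map_comp. Qed.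

Lemma shift_run_crit k s s' : [seq e <- s | e.2] = [seq e <- s' | e.2] ->
  [seq e <- shift_run k s | e.2] = [seq e <- shift_run k s' | e.2].
Proof. by move=> eqs; rewrite !filter_map /preim /= eqs. Qed.

Lemma count_shift_run k s i b : 
  count_mem (k + i, b)%N (shift_run k s) = count_mem (i, b) s.
Proof.
rewrite /shift_run count_map; apply: eq_count => e /=.
by rewrite !xpair_eqE eqn_add2l -xpair_eqE -surjective_pairing.
Qed.

Lemma count_shift_run_lt k s i b : (i < k)%N -> count_mem (i, b) (shift_run k s) = 0%N.
Proof.
move=> ik; apply/count_memPn/negP => /mapP[e _ [eq_i _]].
by move: ik; rewrite eq_i ltnNge leq_addr.
Qed.

Lemma count_crit (i : nat) (s s' : seq (nat * bool)) : [seq e <- s | e.2] = [seq e <- s' | e.2] ->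
  count_mem (i, true) s = count_mem (i, true) s'.
Proof.
have cE t : count_mem (i, true) t = count_mem (i, true) [seq e <- t | e.2].
  by rewrite count_filter; apply: eq_count => -[j []] /=; rewrite !xpair_eqE ?andbT ?andbF.
by rewrite cE (cE s') => ->.
Qed.

(** The marked [g] occurs once among all runs of [P], so the scalar of run 0 of [Q] enters the
    product of scalars exactly once and completes the sign of [Q]. The unmarked occurrences become
    [Pi_0] in every branch and add no scalar. *)
Lemma run_plan_comp C P Q g KP SP wP KQ SQ wQ :
  (g < hpp_n P)%N -> hpp_ok P -> hpp_ok Q ->
  run_plan C P KP SP wP -> run_plan C Q KQ SQ wQ ->
  run_plan C (hpp_comp P Q g) (KP + KQ) (comp_S P Q g KP SP SQ) (comp_w P Q g KP wP wQ).
Proof.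
move=> gP okP okQ planP planQ.
have [ltP subP permP critP crit1P mainP valP] := planP.
have [ltQ subQ permQ critQ crit1Q mainQ valQ] := planQ.
set k := (hpp_n P).-1; set B := [seq (k + j, false)%N | j <- nth [::] (hpp_words Q) 0].
have nxQ0 := ok_nx _ okQ; have nxP0 := ok_nx _ okP.
have critB : all (fun e => ~~ e.2) B by apply/allP => e /mapP[j _ ->].
have leB e : e \in B -> (k <= e.1)%N by move=> /mapP[j _ ->]; apply: leq_addr.
have leA s e : e \in shift_run k s -> (k <= e.1)%N.
  by move=> /mapP[e' _ ->]; apply: leq_addr.
have ltB e : e \in B -> (e.1 < k + hpp_n Q)%N.
  move=> /mapP[j jw ->] /=; rewrite ltn_add2l.
  by move: jw; rewrite (perm_mem (ok_perm _ okQ _ nxQ0)) mem_iota.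
have ltA t e : (t <= KQ)%N -> e \in shift_run k (SQ t) -> (e.1 < k + hpp_n Q)%N.
  by move=> tK /mapP[e' eS ->] /=; rewrite ltn_add2l; apply: (ltQ t).
have tQ t : (t <= KP + KQ)%N -> (t - KP <= KQ)%N by lia.
have div0 : (0 %/ hpp_nx Q = 0)%N by rewrite div0n.
have mod0 : (0 %% hpp_nx Q = 0)%N by rewrite mod0n.
split; rewrite /comp_S /comp_w -/k -/B.
- move=> t e tK; rewrite /= (_ : (hpp_n P + hpp_n Q).-1 = k + hpp_n Q)%N; last by rewrite /k; lia.
  case: ifP => [tP|_]; last by apply: ltA; apply: tQ.
  move=> /flattenP[s /mapP[e' /(ltP _ _ tP) e'P ->]].
  case: (eqVneq e'.1 g) => [_|ne_g]; first by case: ifP => _; [apply: (ltA 0%N)|apply: ltB].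
  rewrite inE => /eqP -> /=; rewrite /comp_relabel /k; move: (e'.1) ne_g e'P => j.
  by case: ifP; lia.
- move=> t x tK /ltn_divmod[x1 x2]; case: ifP => [tP|_].
    by apply: subst_run_sub; [apply: map_subseq; apply: subQ|apply: subP].
  by apply: map_subseq; apply: subQ => //; apply: tQ.
- move=> t x tK /ltn_divmod[x1 x2]; rewrite div0 mod0; case: ifP => [tP|_].
    by apply: subst_run_perm; [apply: perm_map; apply: permQ|apply: permP].
  by apply: perm_map; apply: permQ => //; apply: tQ.
- move=> t x tK /ltn_divmod[x1 x2]; case: ifP => [tP|_].
    by apply: subst_run_crit => //; [apply: shift_run_crit; apply: critQ|apply: critP].
  by apply: shift_run_crit; apply: critQ => //; apply: tQ.
- move=> i; rewrite /= => iPQ; rewrite -addSn big_split_ord /=.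
  under eq_bigr => t _ do rewrite -ltnS ltn_ord.
  under [X in (_ + X)%N]eq_bigr => t _ do rewrite ltnNge leq_addr /=.
  have [lt_ik|le_ki] := ltnP i k.
    rewrite [X in (_ + X)%N]big1 ?addn0 => [|t _]; last exact: count_shift_run_lt.
    under eq_bigr => t _ do
      rewrite (subst_run_count_old g _ _ (SP t) k i (leA _) leB lt_ik).
    by apply: crit1P; move: lt_ik; rewrite /k; case: ifP; lia.
  have newE (t : 'I_KP.+1) : count_mem (i, true)
      (subst_run g (shift_run k (SQ 0)) B (SP t))
      = (count_mem (g, true) (SP t) * count_mem (i, true) (shift_run k (SQ 0)))%N.
    apply: (subst_run_count_new _ _ _ _ k) => //; first by rewrite /k; lia.
    by move=> e /(ltP _ _ (ltn_ord t)); rewrite /k; move: (e.1) => j; lia.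
  under eq_bigr => t _ do rewrite newE.
  rewrite -big_distrl /= crit1P // mul1n.
  have iE : i = (k + (i - k))%N by lia.
  rewrite iE count_shift_run -(crit1Q (i - k)%N); last by move: iPQ le_ki; rewrite /k; lia.
  rewrite big_ord_recl; congr (_ + _)%N; apply: eq_bigr => t _.
  by rewrite count_shift_run; congr (count_mem _ (SQ _)); rewrite /= /bump; lia.
- rewrite div0 mod0 leq0n (subst_run_word P _ _ _ _ (nth [::] (hpp_words Q) 0)).
  + by rewrite mainP -comp_nth_word // mul0n addn0.
  + by rewrite shift_runE -mainQ -map_comp.
  + by rewrite -map_comp.
move=> d U y uU ylt prom; have [y1 y2] := ltn_divmod ylt.
have [uUQ uUP promQ promP] := run_plan_comp_val okP okQ gP uU ylt prom.
have [epsP [epsPE epsPP]] := valP _ _ _ uUP y1 promP.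
have [epsQ [epsQE epsQP]] := valQ _ _ _ uUQ y2 promQ.
set UQ := fun j => U (k + j)%N in uUQ promQ epsQE; set q := hpp_prod Q UQ 0.
have shiftU s : word_prod U [seq e.1 | e <- shift_run k s] = word_prod UQ [seq e.1 | e <- s].
  by rewrite shift_runE (map_comp (addn k) fst) word_prod_map.
have BU : word_prod U [seq e.1 | e <- B] = q.
  by rewrite -map_comp (word_prod_map U (addn k)).
have substE t x : (t <= KP)%N -> (x < hpp_nx P * hpp_nx Q)%N ->
    word_prod U [seq e.1 | e <- subst_run g (shift_run k (wQ 0 (x %% hpp_nx Q)%N)) B
        (wP t (x %/ hpp_nx Q)%N)]
    = epsQ 0 (x %% hpp_nx Q)%N ^+ count_mem (g, true) (SP t) *:
      word_prod (subst_gate g q U) [seq e.1 | e <- wP t (x %/ hpp_nx Q)%N].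
  move=> tP /ltn_divmod[x1 x2].
  rewrite -(count_crit _ _ _ (critP t _ tP x1)); apply: subst_run_val.
    by rewrite shiftU epsQE // mainQ.
  exact: BU.
exists (fun t x => if (t <= KP)%N then
   epsQ 0 (x %% hpp_nx Q)%N ^+ count_mem (g, true) (SP t) * epsP t (x %/ hpp_nx Q)%N
   else epsQ (t - KP)%N (x %% hpp_nx Q)%N); split.
  move=> t x tK ltx; have [x1 x2] := ltn_divmod ltx.
  case: ifP => [tP|_]; rewrite ?div0 ?mod0; last first.
    by rewrite !shiftU epsQE // tQ.
  rewrite substE // epsPE // scalerA; congr (_ *: _).
  rewrite (subst_run_val g U _ _ _ 1 q) ?expr1n ?scale1r //.
  by rewrite shiftU mainQ.
move=> x /ltn_divmod[x1 x2]; rewrite -addSn big_split_ord /=.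
under eq_bigr => t _ do rewrite -ltnS ltn_ord.
under [X in _ * X]eq_bigr => t _ do rewrite ltnNge leq_addr /= addSnnS addKn.
rewrite big_split /= epsPP // -expr_sum crit1P // expr1.
rewrite div0 mod0 mulrACA [in RHS]intrM -(epsQP _ x2) big_ord_recl /= [in RHS]mulrCA mulrA.
by congr (_ * _); apply: eq_bigr.
Qed.

Lemma big_comp_gates {R : Type} {idx : R} (op : Monoid.com_law idx) (P Q : hpp)
    (g : nat) (F : nat -> R) :
  (g < hpp_n P)%N ->
  \big[op/idx]_(i < hpp_n (hpp_comp P Q g)) F i =
  op (\big[op/idx]_(i < hpp_n P | i != g :> nat) F (comp_relabel g i))
     (\big[op/idx]_(j < hpp_n Q) F ((hpp_n P).-1 + j)%N).
Proof.
move=> gP /=; have -> : (hpp_n P + hpp_n Q).-1 = ((hpp_n P).-1 + hpp_n Q)%N by lia.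
rewrite big_split_ord /=; congr (op _ _).
case: (hpp_n P) gP => // n gP /=.
rewrite [RHS]big_mkcond /= (bigD1_ord (Ordinal gP)) //= eqxx /= Monoid.mul1m.
apply: eq_bigr => i _; rewrite /= /bump /comp_relabel.
case: (leqP g i) => gi; rewrite ?add1n ?add0n.
  by rewrite ifT ?ifF //; lia.
by rewrite ifT ?ifT //; lia.
Qed.

(** * A plan for a single problem *)

(** Each copy of [l] supplies one letter of [a]. *)
Lemma subseq_flatten_nseq {T : eqType} (a l : seq T) r :
  {subset a <= l} -> (size a <= r)%N -> subseq a (flatten (nseq r l)).
Proof.
elim: a r => [|x a IHa] [|r] //= sub_al; first by rewrite sub0seq.
rewrite ltnS -[x :: a]/([:: x] ++ a) => size_a.
apply: cat_subseq; first by rewrite sub1seq sub_al ?mem_head.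
by apply: IHa => // i ia; apply: sub_al; rewrite in_cons ia orbT.
Qed.

(** Bernoulli's inequality for [(1 + 1/m)^k], with denominators cleared in [bern], at [k = m]. *)
Lemma double_expn_leq m : (0 < m -> 2 * m ^ m <= m.+1 ^ m)%N.
Proof.
move=> m0; have bern k : (m ^ k * (m + k) <= m * m.+1 ^ k)%N.
  elim: k => [|k IHk]; first by rewrite !expn0; lia.
  rewrite !expnS; apply: (@leq_trans (m.+1 * (m ^ k * (m + k)))%N).
    by move: (m ^ k)%N => e; nia.
  by rewrite [X in (_ <= X)%N]mulnCA leq_mul2l IHk orbT.
have := bern m; rewrite addnn -muln2 -(leq_pmul2l m0).
by move: (m ^ m)%N (m.+1 ^ m)%N => a b; nia.
Qed.

(** An entropy bound. A gate other than the heaviest gate [h] has at most half of the total weight,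
    so replacing its base [m i] by the total gains [2 ^ m i]. If a second weight is positive, the
    total exceeds [m h] and the heavy gate gains one more factor 2. *)
Lemma expn_leq_weight n (m : nat -> nat) h : (h < n)%N ->
  (forall i, (i < n)%N -> m i <= m h)%N ->
  (2 ^ (\sum_(i < n | i != h :> nat) m i + (1 < \sum_(i < n) (0 < m i)))
    * \prod_(i < n) m i ^ m i <= (\sum_(i < n) m i) ^ (\sum_(i < n) m i))%N.
Proof.
move=> hn maxh; pose h' := Ordinal hn.
rewrite !(bigD1 (P := predT) h') //=.
rewrite -![\sum_(i < n | i != h') _]/(\sum_(i < n | i != h :> nat) _).
rewrite -[\prod_(i < n | i != h') _]/(\prod_(i < n | i != h :> nat) m i ^ m i)%N.
set L := (\sum_(i < n | i != h :> nat) m i)%N.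
have leL (i : 'I_n) : i != h :> nat -> (m i <= L)%N.
  by move=> ih; rewrite /L (bigD1 i) //= leq_addr.
have le_light : (2 ^ L * \prod_(i < n | i != h :> nat) m i ^ m i <= (m h + L) ^ L)%N.
  have expL a : (a ^ L = \prod_(i < n | i != h :> nat) a ^ m i)%N.
    by rewrite /L expn_sum.
  rewrite !expL -big_split /=; apply: leq_prod => i ih; rewrite -expnMn; case: (posnP (m i)) => [->|mi0].
    by rewrite !expn0.
  by rewrite leq_exp2r //; have := leL i ih; have := maxh i (ltn_ord i); lia.
have le_heavy : (2 ^ (1 < (0 < m h) + \sum_(i < n | i != h :> nat) (0 < m i))
    * m h ^ m h <= (m h + L) ^ m h)%N.
  have [m0|mh0] := posnP (m h).
    rewrite m0 !expn0 muln1 big1 // => i _.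
    by have := maxh i (ltn_ord i); rewrite m0 leqn0 => /eqP ->.
  case: (ltnP 1) => /= [supp|_]; last by rewrite mul1n leq_exp2r // leq_addr.
  have L0 : (0 < L)%N.
    apply: leq_trans (_ : (\sum_(i < n | i != h :> nat) (0 < m i) <= L)%N).
      by move: supp; rewrite add1n ltnS.
    by apply: leq_sum => i _; lia.
  apply: leq_trans (double_expn_leq _ mh0) _.
  by rewrite leq_exp2r //; lia.
rewrite 2!expnD [(2 ^ L * _)%N]mulnC mulnACA.
exact: leq_mul le_heavy le_light.
Qed.

Lemma hpp_wf_ok P : hpp_wf P -> hpp_ok P.
Proof.
case=> -[nx0 _ szP permP] [sgn orth]; split=> //.
- by move=> x xP; apply: (allP permP); rewrite mem_nth ?szP.
- by move=> x y xP yP; case: (sgn x y xP yP) => ->.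
Qed.

(** The test covers a problem without gates, which has no heavy gate. *)
Definition heavy_mid (n h : nat) : seq (nat * bool) := if (h < n)%N then [:: (h, true)] else [::].
Definition light_gates (n h : nat) : seq nat := [seq i <- iota 0 n | i != h].

(* The critical occurrence of the heavy gate [h] is surrounded by enough
   copies of the other gates to accommodate every arrangement of them. *)
Definition base_S (n h t : nat) : seq (nat * bool) :=
  if t is t'.+1 then [:: (nth 0%N (light_gates n h) t', true)]
  else let side := flatten (nseq n.-1 [seq (i, false) | i <- light_gates n h]) in
    side ++ heavy_mid n h ++ side.

(** The later runs are the same in all branches: each holds the marked call of a light gate, where a
    new heavy path starts. *)
Definition base_w (P : hpp) (h t x : nat) : seq (nat * bool) :=
  if t is 0 then [seq (i, i == h) | i <- nth [::] (hpp_words P) x]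
  else base_S (hpp_n P) h t.

Lemma map_fst_flag h (s : seq nat) : [seq e.1 | e <- [seq (i, i == h) | i <- s]] = s.
Proof. by rewrite -map_comp map_id. Qed.

Lemma run_plan_base C P h : hpp_ok P -> ((0 < hpp_n P) -> (h < hpp_n P))%N ->
  run_plan C P (size (light_gates (hpp_n P) h)) (base_S (hpp_n P) h) (base_w P h).
Proof.
move=> okP hP; set n := hpp_n P; set O := light_gates n h.
(* A word splits at the heavy gate into two pieces of at most [n - 1] light gates, each of which
   embeds into one side of run 0. *)
have wordE x : (x < hpp_nx P)%N -> n = 0%N /\ nth [::] (hpp_words P) x = [::] \/
    exists a b, [/\ (h < n)%N, nth [::] (hpp_words P) x = a ++ h :: b,
      ((size a <= n.-1) && (size b <= n.-1))%N, {subset a <= O} & {subset b <= O}].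
  move=> xP; have := ok_perm _ okP _ xP; rewrite -/n.
  case: (posnP n) => [->|n0]; first by move=> /perm_nilP ->; left.
  move=> pw; right; have hn := hP n0.
  have hw : h \in nth [::] (hpp_words P) x by rewrite (perm_mem pw) mem_iota.
  have uw : uniq (nth [::] (hpp_words P) x) by rewrite (perm_uniq pw) iota_uniq.
  have szw := perm_size pw; have memw := perm_mem pw.
  case/splitPr: hw uw szw memw => a b; rewrite cat_uniq /= negb_or size_cat size_iota /=.
  move=> /and4P[_ /andP[ha _] hb _] szw memw; exists a, b; split=> //; first by lia.
    move=> i ia; rewrite mem_filter -memw mem_cat ia andbT.
    by apply: contraNneq ha => <-.
  move=> i ib; rewrite mem_filter -memw mem_cat in_cons ib !orbT andbT.
  by apply: contraNneq hb => <-.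
have flagE a : {subset a <= O} -> [seq (i, i == h) | i <- a] = [seq (i, false) | i <- a].
  move=> aO; apply/eq_in_map => i /aO; rewrite mem_filter.
  by case: eqP.
have ltO i : i \in O -> (i < n)%N by rewrite mem_filter mem_iota => /andP[_].
split.
- move=> [|t] e tK /=.
    have sideP : e \in flatten (nseq n.-1 [seq (i, false) | i <- O]) -> (e.1 < n)%N.
      by move=> /flattenP[s /nseqP[-> _] /mapP[i /ltO ? ->]].
    rewrite !mem_cat => /or3P[/sideP //||/sideP //].
    by rewrite /heavy_mid; case: ifP => // ?; rewrite inE => /eqP ->.
  by rewrite inE => /eqP -> /=; apply/ltO/mem_nth.
- move=> [|t] x _ xP; last exact: subseq_refl.
  rewrite /=; case: (wordE x xP) => [[_ ->]|]; first exact: sub0seq.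
  move=> [a [b [hn -> /andP[sa sb] aO bO]]].
  rewrite map_cat /= eqxx /heavy_mid hn !flagE //.
  apply: cat_subseq; first apply: subseq_flatten_nseq; rewrite ?size_map //.
    by move=> e /mapP[i /aO iO ->]; apply: map_f.
  rewrite /= eqxx; apply: subseq_flatten_nseq; rewrite ?size_map //.
  by move=> e /mapP[i /bO iO ->]; apply: map_f.
- move=> [|t] x _ xP; last exact: perm_refl.
  apply: perm_map.
  apply: perm_trans (ok_perm _ okP _ xP) _; rewrite perm_sym.
  exact: ok_perm (ok_nx _ okP).
- have side0 (s : seq nat) : [seq e <- [seq (i, false) | i <- s] | e.2] = [::].
    by elim: s.
  have sides0 r : [seq e <- flatten (nseq r [seq (i, false) | i <- O]) | e.2] = [::].
    by elim: r => //= r IHr; rewrite filter_cat IHr side0.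
  move=> [|t] x _ xP //=; rewrite !filter_cat sides0 cats0 /=.
  case: (wordE x xP) => [[n0 ->]|]; first by rewrite /heavy_mid n0.
  move=> [a [b [hn -> /andP[sa sb] aO bO]]].
  by rewrite map_cat /= eqxx /heavy_mid hn !flagE // filter_cat /= !side0.
- move=> i iP; rewrite big_ord_recl /= !count_cat.
  have side0 : count_mem (i, true) (flatten (nseq n.-1 [seq (i, false) | i <- O])) = 0%N.
    apply/count_memPn/negP => /flattenP[s /nseqP[-> _] /mapP[j _]] //.
  rewrite side0 addn0 /heavy_mid hP ?(leq_ltn_trans _ iP) //=.
  rewrite (eq_bigr (fun t : 'I_(size O) => nat_of_bool (nth 0%N O t == i))); last first.
    by move=> t _; rewrite xpair_eqE andbT addn0.
  have -> : (\sum_(t < size O) (nth 0%N O t == i) = count_mem i O)%N.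
    by rewrite -sum1_count [RHS]big_mkcond /= [RHS](big_nth 0%N) [RHS]big_mkord;
      apply: eq_bigr => t _; case: eqP.
  rewrite count_uniq_mem ?filter_uniq ?iota_uniq // mem_filter mem_iota iP xpair_eqE.
  by rewrite [h == i]eq_sym; case: eqP.
- by rewrite /= map_fst_flag.
- move=> d U y uU yP prom.
  (* Run 0 carries the whole sign. *)
  exists (fun t x => if t == 0%N then (hpp_sign P x y * hpp_sign P 0 y)%:~R else 1); split.
    move=> [|t] x _ xP /=; last by rewrite scale1r.
    by rewrite !map_fst_flag; apply: prom.
  by move=> x xP; rewrite big_ord_recl /= big1 ?mulr1.
Qed.

(** * Query count *)

Definition run_cost (m : nat -> nat) (K : nat) (S : nat -> seq (nat * bool)) : nat :=
  \sum_(t < K.+1) run_weight m (S t).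

(* [2 ^ cost * prod m_i ^ (c m_i) <= N ^ (c N)], with [N] the total weight, is
   the exponential form of [cost <= c (N log N - sum m_i log m_i)].  The slack
   of twice (number of gates of positive weight) - 1 pays in the end for the
   critical calls. *)
Definition efficient (c n : nat) (m : nat -> nat) (cost : nat) : bool :=
  (2 ^ (cost + (\sum_(i < n) (0 < m i)).-1.*2) * \prod_(i < n) m i ^ (c * m i)
   <= (\sum_(i < n) m i) ^ (c * \sum_(i < n) m i))%N.

Lemma base_cost n h m : ((0 < n) -> (h < n))%N ->
  run_cost m (size (light_gates n h)) (base_S n h)
  = (n.-1.*2 * \sum_(i < n | i != h :> nat) m i)%N.
Proof.
move=> hn; rewrite /run_cost big_ord_recl [X in (_ + X)%N]big1 ?addn0 => [|t _]; last first.
  by rewrite /run_weight /= big_cons big_nil.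
rewrite /run_weight /base_S !big_cat /=.
have -> : (\sum_(e <- heavy_mid n h | ~~ e.2) m e.1 = 0)%N.
  by rewrite /heavy_mid; case: ifP => _; rewrite ?big_cons big_nil.
have sideE r : (\sum_(e <- flatten (nseq r [seq (i, false) | i <- light_gates n h]) | ~~ e.2) m e.1
   = r * \sum_(i < n | i != h :> nat) m i)%N.
  elim: r => [|r IHr] /=; first by rewrite big_nil.
  rewrite big_cat /= IHr mulSn; congr (_ + _)%N.
  by rewrite big_map /= big_filter -{1}(subn0 n) big_mkord.
by rewrite !sideE -addnn mulnDl.
Qed.

(** This is the [c]-th power of [expn_leq_weight]. The slack is nonzero only if at least two gates
    have positive weight, and then [2 (s - 1) <= 2 (n - 1) <= c], so the extra factor 2 there pays
    for it. *)
Lemma base_efficient c n h m : (n.-1.*2 <= c)%N -> ((0 < n) -> (h < n))%N ->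
  (forall i, i < n -> m i <= m h)%N ->
  efficient c n m (run_cost m (size (light_gates n h)) (base_S n h)).
Proof.
move=> nc hn maxh; rewrite /efficient base_cost //.
case: (posnP n) => [->|n0]; first by rewrite !big_ord0 !muln0.
have := expn_leq_weight n m h (hn n0) maxh.
set L := (\sum_(i < n | _) _)%N; set N := (\sum_(i < n) m i)%N.
set s := (\sum_(i < n) _)%N => lew.
have sn : (s <= n)%N.
  by rewrite -[X in (_ <= X)%N]card_ord -sum1_card leq_sum // => i _; case: (0 < m i)%N.
apply: (@leq_trans ((2 ^ (L + (1 < s)) * \prod_(i < n) m i ^ m i) ^ c)).
  have prodX : ((\prod_(i < n) m i ^ m i) ^ c = \prod_(i < n) m i ^ (c * m i))%N.
    rewrite [RHS](eq_bigr (fun i : 'I_n => (m i ^ m i) ^ c)%N) => [|i _]; last first.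
      by rewrite -expnM mulnC.
    exact: (big_morph (fun x => x ^ c)%N (fun a b => expnMn a b c) (exp1n c)).
  rewrite expnMn -expnM prodX.
  rewrite leq_mul2r leq_exp2l // mulnDl; apply/orP; right; apply: leq_add.
    by rewrite mulnC leq_mul2l nc orbT.
  case: (ltnP 1 s) => s1 /=; last by move: s1; case: (s) => [|[]].
  by rewrite mul1n; apply: leq_trans nc; rewrite leq_double; lia.
by rewrite [(c * N)%N]mulnC expnM; case: (c) => // c'; rewrite leq_exp2r.
Qed.

(** An unmarked [g] becomes one copy of each gate of [Q]; the single marked [g] becomes run 0 of
    [Q], which completes the cost of [Q]. *)
Lemma comp_cost P Q g KP SP wP KQ SQ m C :
  (g < hpp_n P)%N -> hpp_ok Q -> run_plan C P KP SP wP ->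
  let mQ j := m ((hpp_n P).-1 + j)%N in
  run_cost m (KP + KQ) (comp_S P Q g KP SP SQ)
  = (run_cost (subst_gate g (\sum_(j < hpp_n Q) mQ j)%N m) KP SP
     + run_cost mQ KQ SQ)%N.
Proof.
move=> gP okQ planP mQ; rewrite /run_cost -addSn big_split_ord /= /comp_S.
under eq_bigr => t _ do rewrite -ltnS ltn_ord subst_run_weight.
under [X in (_ + X)%N]eq_bigr => t _ do rewrite ltnNge leq_addr /= addSnnS addKn.
have shiftE s : run_weight m (shift_run (hpp_n P).-1 s) = run_weight mQ s.
  by rewrite /run_weight big_map.
have -> : run_weight m [seq ((hpp_n P).-1 + j, false)%N | j <- nth [::] (hpp_words Q) 0]
    = (\sum_(j < hpp_n Q) mQ j)%N.
  rewrite /run_weight big_map /= (perm_big _ (ok_perm _ okQ _ (ok_nx _ okQ))) /=.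
  by rewrite -{1}(subn0 (hpp_n Q)) big_mkord.
rewrite big_split /= -addnA; congr (_ + _)%N.
rewrite -big_distrl /= (rp_crit1 _ _ _ _ _ planP g gP) mul1n.
rewrite [RHS]big_ord_recl /= shiftE; congr (_ + _)%N.
by apply: eq_bigr => t _; rewrite shiftE.
Qed.

(** The bounds telescope: the factor [NQ ^ (c * NQ)] of the replaced gate, on the left for [P], is
    the right side for [Q]. *)
Lemma comp_efficient c P Q g m costP costQ :
  (g < hpp_n P)%N ->
  let mQ j := m ((hpp_n P).-1 + j)%N in
  efficient c (hpp_n P) (subst_gate g (\sum_(j < hpp_n Q) mQ j)%N m) costP ->
  efficient c (hpp_n Q) mQ costQ ->
  efficient c (hpp_n (hpp_comp P Q g)) m (costP + costQ).
Proof.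
move=> gP mQ; rewrite /efficient; set NQ := (\sum_(j < hpp_n Q) mQ j)%N.
set mP := subst_gate g NQ m => effP effQ.
have mPg : mP g = NQ by rewrite /mP /subst_gate eqxx.
have mPE (i : 'I_(hpp_n P)) : i != g :> nat -> m (comp_relabel g i) = mP i.
  by rewrite /mP /subst_gate => /negbTE ->.
pose g' := Ordinal gP.
have sumE (f : nat -> nat) : (\sum_(i < hpp_n P) f (mP i)
    = f NQ + \sum_(i < hpp_n P | i != g :> nat) f (m (comp_relabel g i)))%N.
  rewrite (bigD1 g') //= mPg; congr (_ + _)%N; apply: eq_big => // i ig.
  by rewrite mPE.
have prodE (f : nat -> nat) : (\prod_(i < hpp_n P) f (mP i)
    = f NQ * \prod_(i < hpp_n P | i != g :> nat) f (m (comp_relabel g i)))%N.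
  rewrite (bigD1 g') //= mPg; congr (_ * _)%N; apply: eq_big => // i ig.
  by rewrite mPE.
rewrite (big_comp_gates _ P Q g (fun i => m i ^ (c * m i))%N) //.
rewrite (big_comp_gates _ P Q g (fun i => nat_of_bool (0 < m i)%N)) //.
rewrite (big_comp_gates _ P Q g m) //= -/NQ.
move: effP effQ; rewrite (sumE id) (sumE (fun a => nat_of_bool (0 < a)%N)).
rewrite (prodE (fun a => a ^ (c * a))%N) -/NQ.
set sQ := (\sum_(j < hpp_n Q) (0 < mQ j))%N.
set sP := (\sum_(i < hpp_n P | _) (0 < _))%N.
set pQ := (\prod_(j < hpp_n Q) _)%N; set pP := (\prod_(i < hpp_n P | _) _)%N.
set NP := (\sum_(i < hpp_n P | _) _)%N => effP effQ.
rewrite [(NP + NQ)%N]addnC; apply: leq_trans effP.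
(* The slacks add up exactly, since the replaced gate counts for [P] just when some gate of [Q] has
   positive weight. *)
have sQ0 : (sQ.-1 + ((0 < NQ) + sP).-1 = (sP + sQ).-1)%N.
  have : (0 < NQ)%N = (0 < sQ)%N.
    rewrite !lt0n !sum_nat_eq0; congr (~~ _); apply: eq_forallb => j.
    by rewrite eqb0 -leqNgt leqn0.
  move=> ->; lia.
rewrite -sQ0.
apply: (@leq_trans (2 ^ (costP + ((0 < NQ) + sP).-1.*2) * pP
    * (2 ^ (costQ + sQ.-1.*2) * pQ))%N).
  rewrite mulnACA -expnD leq_mul2r leq_exp2l //; apply/orP; right.
  by rewrite doubleD; lia.
by rewrite [(NQ ^ _ * pP)%N]mulnC [X in (_ <= X)%N]mulnA leq_mul2l effQ orbT.
Qed.

(** The plan may depend on the weights, which vary in the induction: the heavy gate of a base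
    problem is its heaviest one, and the gate replaced by [Q] must weigh as much as all of [Q]. *)
Lemma class_plan (C : numClosedFieldType) (F : seq hpp) P :
  (forall P, List.In P F -> hpp_wf P) -> in_class F P ->
  hpp_ok P /\ forall m, exists K S w, run_plan C P K S w /\
    efficient (2 * (kmax F).-1) (hpp_n P) m (run_cost m K S).
Proof.
move=> wfF; elim=> {P} [P PF | P Q g _ [okP planP] _ [okQ planQ] gP].
  have okP := hpp_wf_ok _ (wfF _ PF); split=> // m.
  have [h [hP maxh]] : exists h, ((0 < hpp_n P) -> (h < hpp_n P))%N /\
      (forall i, i < hpp_n P -> m i <= m h)%N.
    case: (posnP (hpp_n P)) => [->|n0]; first by exists 0%N.
    case: (arg_maxnP (fun i : 'I_(hpp_n P) => m i) (isT : predT (Ordinal n0))) => h _ maxh.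
    by exists h; split=> // i iP; apply: (maxh (Ordinal iP)).
  exists (size (light_gates (hpp_n P) h)), (base_S (hpp_n P) h), (base_w P h).
  split; first exact: run_plan_base.
  apply: base_efficient => //; rewrite -mul2n leq_mul2l /=.
  suff : (hpp_n P <= kmax F)%N by lia.
  rewrite /kmax; elim: (F) PF => //= P' F' IHF [-> | PF].
    by rewrite big_cons leq_maxl.
  by rewrite big_cons; apply: leq_trans (IHF PF) (leq_maxr _ _).
split=> [|m]; first exact: hpp_comp_ok.
have [KQ [SQ [wQ [pQ effQ]]]] := planQ (fun j => m ((hpp_n P).-1 + j)%N).
have [KP [SP [wP [pP effP]]]] := planP (subst_gate g
  (\sum_(j < hpp_n Q) m ((hpp_n P).-1 + j))%N m).
exists (KP + KQ)%N, (comp_S P Q g KP SP SQ), (comp_w P Q g KP wP wQ).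
split; first exact: run_plan_comp.
by rewrite (comp_cost _ _ _ _ _ _ _ _ _ _ gP okQ pP); apply: comp_efficient.
Qed.

(** At unit weights the cost counts the unmarked calls, and each gate has one marked call. *)
Lemma run_plan_size C P K S w : run_plan C P K S w ->
  (\sum_(t < K.+1) size (S t) = run_cost (fun=> 1) K S + hpp_n P)%N.
Proof.
move=> plan; rewrite /run_cost /run_weight.
have critE : (\sum_(t < K.+1) count snd (S t) = hpp_n P)%N.
  transitivity (\sum_(t < K.+1) \sum_(i < hpp_n P) count_mem (i : nat, true) (S t))%N.
    apply: eq_bigr => t _; have := rp_lt _ _ _ _ _ plan t _ (ltn_ord t).
    elim: (S t) => [|[j b] s IHs] ltS /=; first by rewrite big1.
    rewrite big_split /= -IHs => [|e es]; last by apply: ltS; rewrite in_cons es orbT.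
    congr (_ + _)%N; have jP := ltS (j, b) (mem_head _ _).
    rewrite (bigD1 (Ordinal jP)) //= big1 => [|i /negbTE ne].
      by rewrite xpair_eqE eqxx; case: (b).
    by rewrite xpair_eqE eq_sym -[i == j :> nat]/(i == Ordinal jP) ne.
  rewrite exchange_big /= -[RHS]card_ord -sum1_card; apply: eq_bigr => i _.
  exact: rp_crit1 plan _ (ltn_ord i).
rewrite -critE -big_split /=; apply: eq_bigr => t _.
by rewrite sum1_count -(count_predC snd (S t)) addnC.
Qed.

Theorem mainTheorem2 (R : realType) (F : seq hpp) :
  (forall P, List.In P F -> hpp_wf P) ->
  forall P, in_class F P -> (2 <= hpp_n P)%N ->
  forall d : nat, (0 < d)%N ->
  exists A : causal_algo R[i] d,
    [/\ ca_valid (hpp_n P) A, ca_solves P A &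
        ((ca_queries A)%:R : R) <=
          (2 * (kmax F).-1)%:R * (hpp_n P)%:R
            * (ln ((hpp_n P)%:R : R) / ln (2 : R))].
Proof.
move=> wfF P classP n2 d d0.
have [okP plans] := class_plan R[i] F P wfF classP.
have [K [S [w [plan eff]]]] := plans (fun=> 1%N).
have [A [validA solvesA lenA]] := run_plan_solves _ _ _ _ _ _ okP plan d0.
exists A; split=> //; rewrite lenA (run_plan_size _ _ _ _ _ plan).
set n := hpp_n P; set c := (2 * _)%N; set q := (_ + n)%N.
(* The slack [2 (n - 1)] is at least [n] for [n >= 2], which pays for the [n] marked calls. *)
have {eff} qn : (2 ^ q <= n ^ (c * n))%N.
  move: eff; rewrite /efficient [(\prod_(i < _) _)%N]big1 => [|i _]; last by rewrite exp1n.
  rewrite !sum1_card card_ord muln1 -/n -/c; apply: leq_trans.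
  rewrite leq_exp2l // /q leq_add2l; move: n2; rewrite -/n; lia.
have ln2 : 0 < ln (2 : R) by rewrite ln_gt0 // ltr1n.
(* Multiplied by [ln 2], the claim is the logarithm of [qn]. *)
rewrite mulrA ler_pdivlMr // -natrM !mulr_natl -!lnXn ?ltr0n ?(ltnW n2) //.
by rewrite ler_ln ?posrE ?exprn_gt0 ?ltr0n ?(ltnW n2) // -!natrX ler_nat.
Qed.
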